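(* Let $\lambda\in(\frac12,1)$ and let $F_\lambda:(0,1]\to(0,1]$ be the piecewise linear map given by $F_\lambda(x)=\frac{x-\lambda}{1-\lambda}$ for $x\in X_1$ and $F_\lambda(x)=\frac{x-\lambda^n}{\lambda(1-\lambda)}$ for $x\in X_n$, $n\ge2$, where $X_n=(\lambda^n,\lambda^{n-1}]$. Let $J(\alpha)$ denote the level sets of the Lyapunov exponent of $F_\lambda$. Then for any $t>\frac{-\log2}{\log\lambda}$, $$\dim_HJ\left(-\log(1-\lambda)-\frac{\lambda^t\log\lambda}{1-\lambda^t}\right)=\frac{t\log(1-\lambda)-\log(1-\lambda^t)}{-\log(1-\lambda)-\frac{\lambda^t\log\lambda}{1-\lambda^t}}+t,$$ and $\dim_H\big(J(-\log(\lambda(1-\lambda)))\big)=1$. In particular the function $\alpha\mapsto\dim_HJ(\alpha)$ is analytic in $(\alpha_m,\alpha_M)$ but discontinuous at $\alpha_M$, where $\alpha_m=-\log(1-\lambda)$ and $\alpha_M=-\log(\lambda(1-\lambda))$.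
   Context: $\dim_H$ is Hausdorff dimension. $|F_\lambda'|$ equals $\frac1{1-\lambda}$ on $X_1$ and $\frac1{\lambda(1-\lambda)}$ on $X_n$, $n\ge2$. $J(\alpha)=\{x\in(0,1]:\lim_{n\to\infty}\frac1n\sum_{i=0}^{n-1}\log|F_\lambda'(F_\lambda^ix)|=\alpha\}$. The numbers $\alpha_m$ and $\alpha_M$ are respectively the infimum and the supremum of the values of this limit over the $x\in(0,1]$ for which it exists. *)

(* Defs.v *)
From HB Require Import structures.
From mathcomp Require Import all_boot all_order all_algebra.
From mathcomp Require Import all_classical all_reals all_analysis.
Import Order.TTheory GRing.Theory Num.Theory.
Import numFieldNormedType.Exports.

Set Implicit Arguments.
Unset Strict Implicit.
Unset Printing Implicit Defensive.

Local Open Scope classical_set_scope.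
Local Open Scope ring_scope.

Section hausdorff.
Context {R : realType}.
Implicit Types (A U : set R) (s d : R).
Local Open Scope ereal_scope.

(* On set0 this is -oo, but diam_pow below handles that case apart. *)
Definition diam U : \bar R :=
  ereal_sup [set (`|z.1 - z.2|)%:E | z in U `*` U].

(* The case split gives the empty set cost 0 also for s = 0, so that a
   sequence of sets can stand for an at most countable family. *)
Definition diam_pow s U : \bar R := if U == set0 then 0 else diam U `^ s.

Definition delta_cover d A (U : (set R)^nat) : Prop :=
  A `<=` \bigcup_i U i /\ forall i, diam (U i) <= d%:E.

Definition hausdorff_pre s d A : \bar R :=
  ereal_inf [set \sum_(0 <= i <oo) diam_pow s (U i) | U in delta_cover d A].

Definition hausdorff_measure s A : \bar R :=
  ereal_sup [set hausdorff_pre s d A | d in [set d : R | (0 < d)%R]].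

Definition hausdorff_dim A : \bar R :=
  ereal_inf [set s%:E | s in
    [set s : R | (0 <= s)%R /\ hausdorff_measure s A = 0]].

End hausdorff.

Definition real_analytic_at {R : realType} (f : R -> R) (x0 : R) : Prop :=
  exists (a : R^nat) (r : R), 0 < r /\
    forall x, `|x - x0| < r -> pseries a (x - x0) @ \oo --> f x.

Section lyapunov.
Context {R : realType}.
Context (lambda : R).
Implicit Types (x alpha : R) (n : nat).

Definition X n : set R := `]lambda ^+ n, lambda ^+ n.-1]%classic.

(* The X n, n >= 1, partition ]0, 1]; outside ]0, 1] the value is junk. *)
Definition branch x : nat := xget 1%N [set n | (1 <= n)%N /\ X n x].

Definition F x : R :=
  if branch x == 1%N then (x - lambda) / (1 - lambda)
  else (x - lambda ^+ branch x) / (lambda * (1 - lambda)).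

(* The derivative of F, extended to the right endpoint of each X n by the
   slope of the affine branch on X n. *)
Definition F' x : R :=
  if branch x == 1%N then (1 - lambda)^-1
  else (lambda * (1 - lambda))^-1.

(* At n = 0 this is 0, which does not matter for the limit. *)
Definition lyap_avg x n : R :=
  n%:R^-1 * \sum_(0 <= i < n) ln `|F' (iter i F x)|.

Definition J alpha : set R :=
  [set x | 0 < x <= 1 /\ lyap_avg x @ \oo --> alpha].

Definition lyap_values : set R :=
  [set alpha | exists x, 0 < x <= 1 /\ lyap_avg x @ \oo --> alpha].

(* The default value 0 of inf and sup plays no role when 0 < lambda < 1: the
   set contains - ln (1 - lambda), attained at the fixed point 1, and every
   average lies between the two values of ln |F'|. *)
Definition alpha_m : R := inf lyap_values.
Definition alpha_M : R := sup lyap_values.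

Context (lambda01 : 0 < lambda < 1).

Lemma branchE n x : (1 <= n)%N -> X n x -> branch x = n.
Proof.
have /andP[l0 l1] := lambda01.
have aux m k : (1 <= m)%N -> (m < k)%N -> X m x -> X k x -> False.
  move=> m1 mk; rewrite /X/= !in_itv/= => /andP[mx _] /andP[_ xk].
  have : lambda ^+ k.-1 <= lambda ^+ m.
    by rewrite ler_wiXn2l ?(ltW l0) ?(ltW l1)//; case: k mk {xk}.
  by move=> /(le_trans xk); rewrite leNgt mx.
move=> n1 nx; rewrite /branch; case: xgetP => [k _ [k1 kx]|/(_ n)]; last first.
  by case; split.
have [kn|nk|//] := ltngtP k n.
- by have := aux _ _ k1 kn kx nx.
- by have := aux _ _ n1 nk nx kx.
Qed.

Lemma F_X1 x : X 1 x -> F x = (x - lambda) / (1 - lambda).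
Proof. by move=> xX; rewrite /F (branchE _ xX). Qed.

Lemma F_Xn n x : (2 <= n)%N -> X n x ->
  F x = (x - lambda ^+ n) / (lambda * (1 - lambda)).
Proof.
by move=> n2 xX; rewrite /F (branchE _ xX) ?(ltnW n2)// gtn_eqF.
Qed.

Lemma is_derive_F n x : (1 <= n)%N -> lambda ^+ n < x < lambda ^+ n.-1 ->
  is_derive x 1 F (F' x).
Proof.
move=> n1 xn.
have xX : X n x by rewrite /X/= in_itv/=; case/andP: xn => -> /ltW.
have near_x : \forall y \near x, (y - lambda ^+ n) * F' x = F y.
  have : x \in `]lambda ^+ n, lambda ^+ n.-1[ by rewrite in_itv.
  move=> /near_in_itvoo; apply: filterS => y.
  rewrite in_itv/= => /andP[ny yn].
  have yX : X n y by rewrite /X/= in_itv/= ny ltW.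
  rewrite /F /F' (branchE n1 xX) (branchE n1 yX).
  by have [->|] := eqVneq n 1%N; rewrite ?expr1.
apply: (near_eq_is_derive near_x).
apply: is_derive_eq.
by rewrite subr0 scaler0 add0r /GRing.scale/= mulr1.
Qed.

End lyapunov.

(* Main.v *)
(**
  The map [F] is full-branched up to powers of the base: if [G] denotes the
  map sending each [X n] affinely onto ]0, 1], then
  [iter i F x = lambda ^+ q_i * iter i G x], where [q] is the length of a queue
  receiving [d_i] customers and serving one at each time step, and where the
  digits [d_i] of [x] (one less than the indices of the sets [X n] visited by
  its [G]-orbit) form an arbitrary sequence of natural numbers.  The Lyapunov
  exponent of [x] is affine in the frequency of the times at which the queue
  serves.  For [p < 1] this frequency is [p] iff the digits average to [p], and
  it is [1] as soon as the digits average to some [p >= 1].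

  The cylinder of the first [k] digits, of sum [S], has length
  [(1 - lambda) ^+ k * lambda ^+ S].  Let [p = q / (1 - q)].  If the digits of
  all points of a set average to [p], comparing these lengths with those in base
  [q], whose sum over all words of length [k] is [1], bounds the dimension of the set from
  above.  The same comparison between two bases proves the law of large numbers:
  in base [q] the digits of almost every point average to [p].  The map that
  keeps the digits and turns base [lambda] into base [q] is, on a countable union
  of sets exhausting the level set, Hoelder of every exponent less than that
  bound, and its image has full measure; hence the bound is the dimension.  Base
  [q = lambda] yields dimension 1 at the right end [alpha_M] of the spectrum,
  since there the digits average to [lambda / (1 - lambda) > 1].
*)

Require Import Defs.
From HB Require Import structures.
From mathcomp Require Import all_boot all_order all_algebra.
From mathcomp Require Import all_classical all_reals all_analysis.
From mathcomp Require Import ring lra zify.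
Import Order.TTheory GRing.Theory Num.Theory.
Import numFieldNormedType.Exports.
Set Implicit Arguments.
Unset Strict Implicit.
Unset Printing Implicit Defensive.

Local Open Scope classical_set_scope.
Local Open Scope ring_scope.

(** * Hausdorff measures *)

Section HausdorffContent.
Context {R : realType}.
Implicit Types (A B U : set R) (s d : R).
Local Open Scope ereal_scope.

Lemma diam_ub U x y : U x -> U y -> (`|x - y|)%:E <= diam U.
Proof. by move=> Ux Uy; apply: ereal_sup_ubound; exists (x, y). Qed.

Lemma diam_le U (e : \bar R) :
  (forall x y, U x -> U y -> (`|x - y|)%:E <= e) -> diam U <= e.
Proof. by move=> h; apply: ge_ereal_sup => _ [[x y] [/= Ux Uy] <-]; exact: h. Qed.

Lemma diam_ge0 U : U !=set0 -> 0 <= diam U.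
Proof. by move=> [x Ux]; have := diam_ub Ux Ux; rewrite subrr normr0. Qed.

Lemma diam_pow_ge0 s U : 0 <= diam_pow s U.
Proof. by rewrite /diam_pow; case: ifPn => // _; exact: poweR_ge0. Qed.

Lemma diam_pow_set0 s : diam_pow s (@set0 R) = 0.
Proof. by rewrite /diam_pow eqxx. Qed.

Lemma diam_pow_le s U (r : R) : (0 <= s)%R -> (0 <= r)%R ->
  diam U <= r%:E -> diam_pow s U <= (r `^ s)%:E.
Proof.
move=> s0 r0 Ur; rewrite /diam_pow; case: ifPn => [_|/set0P U0].
  by rewrite lee_fin powR_ge0.
rewrite -poweR_EFin gt0_ler_poweR// in_itv/= leey andbT ?diam_ge0//.
Qed.

Lemma hausdorff_pre_ge0 s d A : 0 <= hausdorff_pre s d A.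
Proof.
apply: le_ereal_inf_tmp => _ [U _ <-].
by apply: nneseries_ge0 => n _ _; exact: diam_pow_ge0.
Qed.

Lemma le_hausdorff_pre s d A B :
  A `<=` B -> hausdorff_pre s d A <= hausdorff_pre s d B.
Proof.
move=> AB; apply: le_ereal_inf => _ [U [BU dU] <-]; exists U => //.
by split=> //; exact: subset_trans BU.
Qed.

Lemma hausdorff_pre_single s d U :
  diam U <= d%:E -> hausdorff_pre s d U <= diam_pow s U.
Proof.
move=> Ud; apply: ereal_inf_lbound.
exists (fun n => if n == 0%N then U else set0).
  split=> [x Ux|[|n]]; first by exists 0%N.
    by [].
  by apply: diam_le => x y [].
rewrite (nneseries_split 0 1)//; last by move=> k _; exact: diam_pow_ge0.
rewrite big_nat1/= eseries0 ?adde0// => -[|i]//= _ _.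
by rewrite diam_pow_set0.
Qed.

Lemma hausdorff_pre_set0 s d : hausdorff_pre s d (@set0 R) = 0.
Proof.
apply/eqP; rewrite eq_le hausdorff_pre_ge0 andbT -(diam_pow_set0 s).
by apply: hausdorff_pre_single; apply: diam_le => x y [].
Qed.

(** Covers of [A i] that are optimal up to [e / 2 ^ i.+1] merge into one cover through a bijection
    between [nat] and [nat * nat]. Such covers exist only where the content is finite, so an
    infinite term is treated first. *)
Lemma hausdorff_pre_sigma_subadditive s d (A : (set R)^nat) :
  hausdorff_pre s d (\bigcup_i A i) <= \sum_(0 <= i <oo) hausdorff_pre s d (A i).
Proof.
have [[i Ai]|Afin] := pselect (exists i, hausdorff_pre s d (A i) = +oo).
  rewrite (eseries_pinfty _ _ Ai) ?leey// => n _.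
  by rewrite gt_eqF// (lt_le_trans _ (hausdorff_pre_ge0 s d (A n))).
apply/lee_addgt0Pr => e e0.
apply: le_trans (epsilon_trick _ (fun n => hausdorff_pre_ge0 s d (A n)) (ltW e0)).
have /choice[U UP] n : exists V : (set R)^nat, delta_cover d (A n) V /\
    \sum_(0 <= k <oo) diam_pow s (V k) <=
      hausdorff_pre s d (A n) + (e / (2 ^ n.+1)%:R)%:E.
  have An : hausdorff_pre s d (A n) \is a fin_num.
    rewrite ge0_fin_numE ?hausdorff_pre_ge0// ltey.
    by apply/eqP => An; apply: Afin; exists n.
  have en0 : (0 < e / (2 ^ n.+1)%:R)%R by rewrite divr_gt0// ltr0n expn_gt0.
  have [_ [U dU <-] ltU] := lb_ereal_inf_adherent en0 An.
  by exists U; split=> //; exact: ltW.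
have /card_esym/ppcard_eqP[f] := card_nat2.
apply: (@le_trans _ _ (\sum_(0 <= k <oo) diam_pow s (U (f k).1 (f k).2))).
  apply: ereal_inf_lbound; exists (fun k => U (f k).1 (f k).2) => //; split.
    move=> x [i _ /(UP i).1.1[j _ Ux]].
    by exists (f^-1%FUN (i, j)) => //=; rewrite invK ?inE.
  by move=> k; exact: (UP _).1.2.
have ge0 i j : 0 <= diam_pow s (U i j) by exact: diam_pow_ge0.
apply: (@le_trans _ _ (\sum_(0 <= i <oo) \sum_(0 <= j <oo) diam_pow s (U i j))).
  rewrite !nneseries_esumT//; last by move=> i; exact: nneseries_ge0.
  under [leRHS]eq_esum do rewrite nneseries_esumT//.
  rewrite esum_esum//.
  rewrite (reindex_esum [set: nat] _ f (fun k => diam_pow s (U k.1 k.2)))//.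
  have : set_bij setT setT f by exact: bij.
  rewrite (_ : setT `*`` _ = setT)//.
  by apply/seteqP; split.
by apply: lee_nneseries => [i _ _|n _]; [by apply: nneseries_ge0 => *|exact: (UP n).2].
Qed.

Lemma hausdorff_pre_bigcup_eq0 s d (A : (set R)^nat) :
  (forall i, hausdorff_pre s d (A i) = 0) ->
  hausdorff_pre s d (\bigcup_i A i) = 0.
Proof.
move=> A0; apply/eqP; rewrite eq_le hausdorff_pre_ge0 andbT.
by rewrite (le_trans (hausdorff_pre_sigma_subadditive _ _ _))// eseries0.
Qed.

Lemma hausdorff_preU_eq0 s d A B : hausdorff_pre s d A = 0 ->
  hausdorff_pre s d B = 0 -> hausdorff_pre s d (A `|` B) = 0.
Proof.
move=> A0 B0; rewrite (_ : A `|` B = \bigcup_i (if i == 0%N then A else B)).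
  by apply: hausdorff_pre_bigcup_eq0 => -[|i].
apply/seteqP; split=> [x [Ax|Bx]|x [[|i] _ /=]]; last 2 first.
- by left.
- by right.
- by exists 0%N.
- by exists 1%N.
Qed.

Lemma hausdorff_measure_eq0 s A : hausdorff_measure s A = 0 <->
  forall d, (0 < d)%R -> hausdorff_pre s d A = 0.
Proof.
split=> [A0 d d0|A0].
  apply/eqP; rewrite eq_le hausdorff_pre_ge0 andbT -A0.
  by apply: ereal_sup_ubound; exists d.
apply/eqP; rewrite eq_le; apply/andP; split.
  by apply: ge_ereal_sup => _ [d /= d0 <-]; rewrite A0.
by rewrite -(A0 1%R)//; apply: ereal_sup_ubound; exists 1%R => /=.
Qed.

Lemma hausdorff_measure_subset_eq0 s A B : A `<=` B ->
  hausdorff_measure s B = 0 -> hausdorff_measure s A = 0.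
Proof.
move=> AB /hausdorff_measure_eq0 B0; apply/hausdorff_measure_eq0 => d d0.
apply/eqP; rewrite eq_le hausdorff_pre_ge0 andbT -(B0 d d0).
exact: le_hausdorff_pre.
Qed.

Lemma hausdorff_dim_eq A (D : R) : (0 <= D)%R ->
  (forall s, (D < s)%R -> hausdorff_measure s A = 0) ->
  (forall s, (0 <= s < D)%R -> hausdorff_measure s A <> 0) ->
  hausdorff_dim A = D%:E.
Proof.
move=> D0 up low; apply/eqP; rewrite eq_le; apply/andP; split.
  apply/lee_addgt0Pr => e e0; apply: ereal_inf_lbound.
  exists (D + e)%R => //=; split; first by rewrite addr_ge0// ltW.
  by apply: up; rewrite ltrDl.
apply: le_ereal_inf_tmp => _ [s [s0 As] <-]; rewrite lee_fin leNgt.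
by apply/negP => sD; apply: (low s) => //; rewrite s0.
Qed.

(** A Hoelder map, given by its graph [h], carries a cover of [A] to a cover of [B] whose diameters
    are at most [C] times the [s]-th powers of the old ones. The bound by 1 makes the images
    admissible at scale 1 whatever [d] is. *)
Lemma hausdorff_pre_holder s d (A B : set R) (C : R) (h : R -> R -> Prop) :
  (0 <= s)%R -> (0 < C)%R ->
  (forall y, B y -> exists2 x, A x & h x y) ->
  (forall x y x' y', A x -> A x' -> B y -> B y' -> h x y -> h x' y' ->
    (`|y - y'| <= C * `|x - x'| `^ s)%R /\ (`|y - y'| <= 1)%R) ->
  hausdorff_pre 1 1 B <= C%:E * hausdorff_pre s d A.
Proof.
move=> s0 C0 hB hold; rewrite -lee_pdivrMl//.
apply: le_ereal_inf_tmp => _ [U [AU dU] <-]; rewrite lee_pdivrMl//.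
pose V i := [set y | B y /\ exists x, [/\ A x, U i x & h x y]].
have V1 i : diam (V i) <= 1.
  apply: diam_le => y y' [By [x [Ax _ xy]]] [By' [x' [Ax' _ xy']]].
  by rewrite lee_fin; have [] := hold _ _ _ _ Ax Ax' By By' xy xy'.
rewrite -nneseriesZl; last by move=> i _; exact: diam_pow_ge0.
apply: (@le_trans _ _ (\sum_(0 <= i <oo) diam_pow 1 (V i))).
  apply: ereal_inf_lbound; exists V => //; split => // y By.
  have [x Ax xy] := hB _ By; have [i _ Ux] := AU _ Ax.
  by exists i => //; split => //; exists x.
apply: lee_nneseries => [i _ _|i _]; first exact: diam_pow_ge0.
rewrite [leLHS]/diam_pow; case: ifPn => [_|/set0P V0].
  by apply: mule_ge0; [rewrite lee_fin ltW|exact: diam_pow_ge0].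
rewrite poweRe1 ?diam_ge0//.
have U0 : U i != set0 by apply/set0P; have [y [_ [x [_ Ux _]]]] := V0; exists x.
rewrite /diam_pow (negbTE U0); apply: diam_le => y y' [By [x [Ax Ux xy]]].
move=> [By' [x' [Ax' Ux' xy']]].
have [+ _] := hold _ _ _ _ Ax Ax' By By' xy xy'.
rewrite -lee_fin EFinM => /le_trans; apply.
rewrite lee_pmul2l// -poweR_EFin gt0_ler_poweR// ?in_itv/= ?leey ?andbT//.
- by rewrite diam_ge0//; apply/set0P.
- exact: diam_ub.
Qed.

(* Each set of a cover lies in an interval of twice its diameter. *)
Lemma itv01_hausdorff_pre_neq0 d :
  hausdorff_pre 1 d `]0%R, 1%R]%classic <> 0 :> \bar R.
Proof.
(* The factor [2^-1] pays for the doubled diameters when the cover is compared with Lebesgue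
   measure. *)
suff H : (2^-1)%:E <= hausdorff_pre 1 d `]0%R, 1%R]%classic.
  by move=> h; move: H; rewrite h lee_fin leNgt invr_gt0 ltr0n.
apply: le_ereal_inf_tmp => _ [U [cU dU] <-].
have Ufin i : U i !=set0 -> diam (U i) \is a fin_num.
  by move=> U0; rewrite ge0_fin_numE ?diam_ge0// (le_lt_trans (dU i))// ltry.
pose V i : set R := if U i == set0 then set0 else
  `[xget 0 (U i) - fine (diam (U i)), xget 0 (U i) + fine (diam (U i))]%classic%R.
have UV i : U i `<=` V i.
  move=> x Ux; have U0 : U i !=set0 by exists x.
  rewrite /V ifF; last by apply/negbTE/set0P.
  have Uc : U i (xget 0%R (U i)) by exact: xgetPex.
  have := diam_ub Ux Uc; rewrite -{1}(fineK (Ufin _ U0)) lee_fin => h.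
  by rewrite /= in_itv/= -ler_distl.
have mV i : measurable (V i).
  by rewrite /V; case: ifPn => _; [exact: measurable0|exact: measurable_itv].
have muV i : lebesgue_measure (V i) <= 2%:E * diam_pow 1 (U i).
  rewrite /V /diam_pow; case: ifPn => [_|/set0P U0]; first by rewrite measure0 mule0.
  rewrite poweRe1 ?diam_ge0// lebesgue_measure_itv/=.
  have := diam_ge0 U0.
  have [r ->] : exists r, diam (U i) = r%:E.
    by exists (fine (diam (U i))); rewrite fineK// Ufin.
  rewrite lee_fin => r0.
  case: ifPn => _; last by rewrite -EFinM lee_fin mulr_ge0.
  by rewrite -EFinB -EFinM lee_fin/=; lra.
have : lebesgue_measure (`]0%R, 1%R]%classic : set R) <= \sum_(0 <= i <oo) lebesgue_measure (V i).
  apply: measure_sigma_subadditive => //.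
  by move=> x /cU[i _ Ux]; exists i => //; exact: UV.
rewrite lebesgue_measure_itv/= lte_fin ltr01 sube0 => /le_trans leV.
rewrite -[(2^-1)%:E]mule1 lee_pdivrMl//; apply: leV.
rewrite -nneseriesZl//; last by move=> i _; exact: diam_pow_ge0.
by apply: lee_nneseries.
Qed.

End HausdorffContent.

(** * Expansions of the points of ]0, 1] *)

Section Expansion.
Context {R : realType}.

Section OneBase.
Variable c : R.
Hypothesis c01 : 0 < c < 1.
Implicit Types (x y : R) (d : nat -> nat).

Let c0 : 0 < c. Proof. by case/andP: c01. Qed.
Let c1 : c < 1. Proof. by case/andP: c01. Qed.
Let cb0 : 0 < 1 - c. Proof. by rewrite subr_gt0. Qed.

(* [F] agrees on [X n] with this map up to a power of the base; here every
   branch is onto, so that the sequences of digits are unrestricted. *)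
Definition full_branch x : R :=
  (x - c ^+ branch c x) / (c ^+ (branch c x).-1 * (1 - c)).

Definition digit x i : nat := (branch c (iter i full_branch x)).-1.

Definition digit_sum x k : nat := (\sum_(i < k) digit x i)%N.

Definition cylinder_length (k S : nat) : R := (1 - c) ^+ k * c ^+ S.

Lemma cylinder_length_gt0 k S : 0 < cylinder_length k S.
Proof. by rewrite mulr_gt0// exprn_gt0. Qed.

Let affine_le1 y : y <= 1 -> c + (1 - c) * y <= 1.
Proof. by move=> y1; have := ler_wpM2l (ltW cb0) y1; rewrite mulr1; lra. Qed.

(** The affine map sending [y] to [c ^+ j * (c + (1 - c) * y)] is the inverse branch of
    [full_branch] with values in [X c j.+1]. *)
Lemma branch_affine y j : 0 < y <= 1 ->
  branch c (c ^+ j * (c + (1 - c) * y)) = j.+1.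
Proof.
move=> /andP[y0 y1]; apply: branchE => //; rewrite /X/= in_itv/=.
have cj := exprn_gt0 j c0.
rewrite exprSr ltr_pM2l// ltrDl mulr_gt0//= -[leRHS]mulr1 ler_pM2l//; exact: affine_le1.
Qed.

Lemma full_branch_affine y j : 0 < y <= 1 ->
  full_branch (c ^+ j * (c + (1 - c) * y)) = y.
Proof.
move=> y01; rewrite /full_branch branch_affine//= exprSr.
have cj : c ^+ j != 0 by rewrite gt_eqF// exprn_gt0.
have cb : 1 - c != 0 by rewrite gt_eqF.
by field; rewrite cb cj.
Qed.

Lemma branch_ex x : 0 < x <= 1 -> exists n, X c n.+1 x.
Proof.
move=> /andP[x0 x1].
have : exists n, c ^+ n < x.
  have /cvgr_lt/(_ _ x0)[N _ NP] : (c ^+ n) @[n --> \oo] --> 0.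
    by apply: cvg_expr; rewrite gtr0_norm.
  by exists N; exact: NP (leqnn N).
move=> /ex_minnP[[|n] nx nmin].
  by move: nx; rewrite expr0 ltNge x1.
exists n; rewrite /X/= in_itv/= nx/= leNgt; apply/negP => /nmin.
by rewrite ltnn.
Qed.

Lemma expansion_step x : 0 < x <= 1 ->
  x = c ^+ digit x 0 * (c + (1 - c) * full_branch x) /\ 0 < full_branch x <= 1.
Proof.
move=> /branch_ex[n nx]; rewrite /digit/= /full_branch (branchE c01 _ nx)//=.
have cn := exprn_gt0 n c0.
have cn0 : c ^+ n != 0 by rewrite gt_eqF.
have cb : 1 - c != 0 by rewrite gt_eqF.
split; first by rewrite exprSr; field; rewrite cb cn0.
move: nx; rewrite /X/= in_itv/= => /andP[nx xn].
rewrite divr_gt0 ?subr_gt0 ?mulr_gt0//= ler_pdivrMr ?mulr_gt0// mul1r.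
by rewrite exprSr; lra.
Qed.

Lemma full_branch01 x i : 0 < x <= 1 -> 0 < iter i full_branch x <= 1.
Proof. by move=> x01; elim: i => //= i /expansion_step[]. Qed.

Lemma digitS x i : digit x i.+1 = digit (full_branch x) i.
Proof. by rewrite /digit iterSr. Qed.

Lemma digit_sumS x k :
  digit_sum x k.+1 = (digit x 0 + digit_sum (full_branch x) k)%N.
Proof.
by rewrite /digit_sum big_ord_recl/=; under eq_bigr do rewrite /= digitS.
Qed.

(** On a cylinder of [k] digits the [k]-th iterate of [full_branch] is affine. Its inverse contracts
    by [(1 - c) * c ^+ d] for each digit [d], and the product of these factors is the length of the
    cylinder. *)
Lemma dist_same_digits k x y : 0 < x <= 1 -> 0 < y <= 1 ->
  (forall i, (i < k)%N -> digit x i = digit y i) ->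
  x - y = cylinder_length k (digit_sum x k) *
          (iter k full_branch x - iter k full_branch y).
Proof.
elim: k x y => [|k IH] x y x01 y01 xy.
  by rewrite /cylinder_length /digit_sum big_ord0 !expr0 !mul1r.
have [ex gx] := expansion_step x01; have [ey gy] := expansion_step y01.
rewrite [in LHS]ex [in LHS]ey (xy 0%N)// !iterSr digit_sumS (xy 0%N)//.
have := IH _ _ gx gy; rewrite -!mulrBr => {}IH.
rewrite [X in _ * X](_ : _ = (1 - c) * (full_branch x - full_branch y)); last by ring.
rewrite IH; last by move=> i ik; rewrite -!digitS xy.
rewrite /cylinder_length exprS exprD.
move: (_ - iter _ _ _) (c ^+ digit y 0) (c ^+ digit_sum _ _) ((1 - c) ^+ k).
by move=> u v w z; ring.
Qed.

Lemma dist_same_digits_le k x y : 0 < x <= 1 -> 0 < y <= 1 ->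
  (forall i, (i < k)%N -> digit x i = digit y i) ->
  `|x - y| <= cylinder_length k (digit_sum x k).
Proof.
move=> x01 y01 xy; rewrite (dist_same_digits x01 y01 xy) normrM.
have cl0 := cylinder_length_gt0 k (digit_sum x k).
rewrite gtr0_norm// ler_piMr//; first exact: ltW.
have := full_branch01 k x01; have := full_branch01 k y01.
by rewrite ler_norml; lra.
Qed.

(* The larger point exceeds the left endpoint of its own cylinder by an amount
   that its next digit controls. *)
Lemma dist_first_diff k x y : 0 < x <= 1 -> 0 < y <= 1 ->
  (forall i, (i < k)%N -> digit x i = digit y i) ->
  (digit y k < digit x k)%N ->
  cylinder_length k.+1 (digit_sum y k.+2).+1 <= `|x - y|.
Proof.
move=> x01 y01 xy ltyx; have yx i : (i < k)%N -> digit y i = digit x i.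
  by move=> ik; rewrite xy.
rewrite distrC; apply: le_trans (ler_norm _).
rewrite (dist_same_digits y01 x01 yx).
set u := iter k full_branch x; set v := iter k full_branch y.
have u01 : 0 < u <= 1 by exact: full_branch01.
have v01 : 0 < v <= 1 by exact: full_branch01.
have [eu gu] := expansion_step u01; have [ev gv] := expansion_step v01.
have [ew gw] := expansion_step gv.
have dv : digit v 0 = digit y k by [].
have dw : digit (full_branch v) 0 = digit y k.+1 by [].
have du : digit u 0 = digit x k by [].
have Sy : digit_sum y k.+2 = (digit_sum y k + digit y k + digit y k.+1)%N.
  by rewrite /digit_sum !big_ord_recr.
rewrite Sy /cylinder_length exprS !exprS !exprD.
(* [u] has the larger first digit, so it lies below the left endpoint of the set [X] containing [v].
   The height of [v] above that endpoint is proportional to [full_branch v], which the next digit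
   bounds from below. *)
have cu : u <= c ^+ (digit y k) * c.
  rewrite -exprSr; apply: (@le_trans _ _ (c ^+ digit x k)); last first.
    by apply: ler_wiXn2l => //; exact: ltW.
  rewrite eu du -[leRHS]mulr1 ler_pM2l ?exprn_gt0//.
  by apply: affine_le1; case/andP: gu.
have cw : c * c ^+ digit y k.+1 <= full_branch v.
  rewrite ew dw mulrC ler_pM2l ?exprn_gt0// lerDl mulr_ge0 ?ltW//.
  by case/andP: gw.
have : c ^+ digit y k * ((1 - c) * (c * c ^+ digit y k.+1)) <= v - u.
  rewrite {1}ev dv mulrDr lerBrDr; apply: le_trans (lerD (lexx _) cu) _.
  by rewrite addrC lerD2l ler_pM2l ?exprn_gt0// ler_pM2l.
have kc : 0 < (1 - c) ^+ k * c ^+ digit_sum y k by rewrite mulr_gt0 ?exprn_gt0.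
rewrite -(ler_pM2l kc) => /(le_trans _); apply; rewrite le_eqVlt.
apply/orP; left; apply/eqP.
move: (c ^+ digit y k) (c ^+ digit_sum y k) (c ^+ digit y k.+1) ((1 - c) ^+ k).
by move=> u1 u2 u3 u4; ring.
Qed.

Lemma cylinder_length_le k S : cylinder_length k S <= (1 - c) ^+ k.
Proof.
have [c0' cb0'] := (ltW c0, ltW cb0).
by rewrite /cylinder_length ler_piMr ?exprn_ge0// exprn_ile1// ltW.
Qed.

Lemma digit_inj x y : 0 < x <= 1 -> 0 < y <= 1 -> digit x =1 digit y -> x = y.
Proof.
move=> x01 y01 xy; apply/eqP; rewrite -subr_eq0 -normr_le0; apply/ler_addgt0Pl => e e0.
have /cvgr_lt/(_ _ e0)[N _ NP] : ((1 - c) ^+ n) @[n --> \oo] --> 0.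
  by apply: cvg_expr; rewrite gtr0_norm// ltrBlDr ltrDl.
rewrite addr0 (le_trans (dist_same_digits_le (k := N) _ _ _))//.
by rewrite (le_trans (cylinder_length_le _ _))// ltW// NP/=.
Qed.

(** Applying the first [n] inverse branches to 0 yields the left endpoint of a cylinder. These
    endpoints increase with [n], so the point sought is their supremum. *)
Fixpoint approx d n : R :=
  if n is m.+1 then c ^+ d 0 * (c + (1 - c) * approx (d \o S) m) else 0.

Definition point_of_digits d : R := sup (range (approx d)).

Lemma approx01 d n : 0 <= approx d n <= 1.
Proof.
elim: n d => [|n IH] d /=; first by rewrite lexx ler01.
have /andP[a0 a1] := IH (d \o S); have cd := exprn_gt0 (d 0) c0.
have a2 : 0 <= c + (1 - c) * approx (d \o S) n.
  by rewrite addr_ge0 ?mulr_ge0 ?(ltW c0) ?(ltW cb0).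
rewrite mulr_ge0 ?(ltW cd)//= -[leRHS]mulr1 ler_pM ?(ltW cd)//.
  by rewrite exprn_ile1 ?(ltW c0) ?(ltW c1).
exact: affine_le1.
Qed.

Lemma approx_nondecreasing d : {homo approx d : n m / (n <= m)%N >-> n <= m}.
Proof.
apply: homo_leq => [//||n]; first exact: le_trans.
elim: n d => [|n IH] d; first by have /andP[] := approx01 d 1.
rewrite /= ler_pM2l ?exprn_gt0// lerD2l ler_pM2l//; exact: IH.
Qed.

Lemma approx_cvg d : approx d n @[n --> \oo] --> point_of_digits d.
Proof.
apply: nondecreasing_cvgn; first exact: approx_nondecreasing.
by exists 1 => _ [n _ <-]; have /andP[] := approx01 d n.
Qed.

Lemma point_of_digitsE d : point_of_digits d =
  c ^+ d 0%N * (c + (1 - c) * point_of_digits (d \o S)).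
Proof.
have h1 : approx d n.+1 @[n --> \oo] --> point_of_digits d.
  by have := @approx_cvg d; rewrite -(cvg_shiftS (approx d)).
have h2 : approx d n.+1 @[n --> \oo] -->
    c ^+ d 0%N * (c + (1 - c) * point_of_digits (d \o S)).
  apply: cvgMr; apply: cvgD; first exact: cvg_cst.
  by apply: cvgMr; exact: approx_cvg.
exact: (cvg_unique _ h1 h2).
Qed.

Lemma point_of_digits01 d : 0 < point_of_digits d <= 1.
Proof.
have h e : 0 <= point_of_digits e <= 1.
  have cvge : cvgn (approx e) by apply/cvg_ex; eexists; exact: approx_cvg.
  rewrite -(cvg_lim (@Rhausdorff R) (@approx_cvg e)) limr_ge ?limr_le//;
    by apply: nearW => n; have /andP[] := approx01 e n.
(* Passing to the limit gives only a weak lower bound; strict positivity comes from the summand [c]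
   in the functional equation. *)
have /andP[_ ->] := h d; rewrite andbT point_of_digitsE.
have /andP[h0 _] := h (d \o S).
by rewrite mulr_gt0 ?exprn_gt0// ltr_wpDr// mulr_ge0// ltW.
Qed.

Lemma digit_point_of_digits d : digit (point_of_digits d) =1 d.
Proof.
move=> i; elim: i d => [|i IH] d.
  by rewrite /digit/= point_of_digitsE branch_affine// point_of_digits01.
by rewrite digitS point_of_digitsE full_branch_affine ?point_of_digits01// IH.
Qed.

End OneBase.
End Expansion.

(** * Covers by cylinders *)

Section Covering.
Context {R : realType}.
Implicit Types (c q th s d : R) (A : set R).

Lemma geometric_nneseries (a q : R) : 0 < q < 1 ->
  (\sum_(0 <= i <oo) (a * q ^+ i)%:E)%E = (a / (1 - q))%:E.
Proof.
move=> /andP[q0 q1]; apply: cvg_lim => //.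
under eq_fun do rewrite sumEFin.
apply: cvg_EFin; first by apply: nearW.
by apply: cvg_geometric_series; rewrite gtr0_norm.
Qed.

Section Cylinders.
Variables (c q th s : R).
Hypotheses (c01 : 0 < c < 1) (q01 : 0 < q < 1) (th01 : 0 < th < 1) (s0 : 0 <= s).

Let light k := [set x : R | 0 < x <= 1 /\
  cylinder_length c k (digit_sum c x k) `^ s <=
  th ^+ k * cylinder_length q k (digit_sum c x k)].

Let light_prefix k (w : seq nat) := light k `&`
  [set x | forall i, (i < size w)%N -> digit c x i = nth 0%N w i].

(** Induction on the number [m] of digits that [w] lacks. At [m = 0] a single cylinder is a cover.
    For the step, the lengths in base [q] form a probability on words: those of the extensions of
    [w] by one digit add up to that of [w], by the geometric series. *)
Let light_prefix_le d k m w : (1 - c) ^+ k <= d -> (size w + m = k)%N ->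
  (hausdorff_pre s d (light_prefix k w) <=
   (th ^+ k * cylinder_length q (size w) (sumn w))%:E)%E.
Proof.
have [[c0 c1] [q0 q1]] := (andP c01, andP q01).
have [t0 t1] := andP th01.
move=> kd; elim: m w => [|m IH] w.
  rewrite addn0 => wk.
  have [->|/set0P[x [[x01 lx] xw]]] := eqVneq (light_prefix k w) set0.
    rewrite hausdorff_pre_set0 lee_fin mulr_ge0 ?exprn_ge0 ?ltW//.
    exact: cylinder_length_gt0.
  have Sx : digit_sum c x k = sumn w.
    rewrite sumnE (big_nth 0%N) big_mkord wk /digit_sum.
    by apply: eq_bigr => i _; rewrite xw// wk.
  have dw : (diam (light_prefix k w) <= (cylinder_length c k (sumn w))%:E)%E.
    apply: diam_le => y z [[y01 _] yw] [[z01 _] zw]; rewrite lee_fin.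
    have -> : sumn w = digit_sum c y k.
      rewrite sumnE (big_nth 0%N) big_mkord wk /digit_sum.
      by apply: eq_bigr => i _; rewrite yw// wk.
    by apply: dist_same_digits_le => // i ik; rewrite yw ?zw ?wk.
  apply: le_trans (hausdorff_pre_single _ _) _.
    by apply: le_trans dw _; rewrite lee_fin (le_trans (cylinder_length_le _ _ _)).
  have := diam_pow_le s0 (ltW (cylinder_length_gt0 c01 _ _)) dw.
  move=> /le_trans; apply; rewrite lee_fin wk.
  by move: lx; rewrite Sx.
move=> wm.
apply: (@le_trans _ _ (hausdorff_pre s d (\bigcup_j light_prefix k (rcons w j)))).
  apply: le_hausdorff_pre => x [lx xw]; exists (digit c x (size w)) => //; split=> //.
  move=> i; rewrite size_rcons nth_rcons ltnS leq_eqVlt => /orP[/eqP->|iw].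
    by rewrite ltnn eqxx.
  by rewrite iw xw.
apply: le_trans (hausdorff_pre_sigma_subadditive _ _ _) _.
pose a := th ^+ k * cylinder_length q (size w) (sumn w).
apply: (@le_trans _ _ (\sum_(0 <= j <oo) (a * (1 - q) * q ^+ j)%:E)%E).
  apply: lee_nneseries => [j _ _|j _]; first exact: hausdorff_pre_ge0.
  apply: le_trans (IH _ _) _; first by rewrite size_rcons addSnnS.
  rewrite lee_fin size_rcons sumn_rcons /a /cylinder_length exprS exprD.
  by rewrite le_eqVlt; apply/orP; left; apply/eqP; ring.
rewrite geometric_nneseries// lee_fin mulfK//.
by rewrite subr_eq0 gt_eqF.
Qed.

(** A Borel-Cantelli argument: the points that are light at level [k] cost at most [th ^+ k],
    because the lengths in base [q] of all words add up to 1, and each point of [A] is light at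
    arbitrarily high levels. *)
Lemma hausdorff_measure_light_cylinders A :
  (forall x, A x -> 0 < x <= 1 /\ forall K, exists2 k, (K <= k)%N &
    cylinder_length c k (digit_sum c x k) `^ s <=
    th ^+ k * cylinder_length q k (digit_sum c x k)) ->
  hausdorff_measure s A = 0%E.
Proof.
move=> AL; apply/hausdorff_measure_eq0 => d d0; apply/eqP.
have [[c0 c1] [t0 t1]] := (andP c01, andP th01).
rewrite eq_le hausdorff_pre_ge0 andbT; apply/lee_addgt0Pr => e e0; rewrite add0e.
(* From level [N] on the cylinders have diameter at most [d], and the total cost is at most the tail
   of a geometric series. *)
have [N [Nd Ne]] : exists N, (1 - c) ^+ N <= d /\ th ^+ N / (1 - th) <= e.
  have h1 : \forall n \near \oo, (1 - c) ^+ n <= d.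
    apply: (cvgr_le 0) => //; apply: cvg_expr.
    by rewrite gtr0_norm ?subr_gt0// ltrBlDr ltrDl.
  have h2 : \forall n \near \oo, th ^+ n <= e * (1 - th).
    apply: (cvgr_le 0); last by rewrite mulr_gt0// subr_gt0.
    by apply: cvg_expr; rewrite gtr0_norm.
  have [N _ NP] := filterI h1 h2.
  exists N; have [h3 h4] := NP N (leqnn N); split=> //.
  by rewrite ler_pdivrMr// subr_gt0.
apply: (@le_trans _ _ (hausdorff_pre s d (\bigcup_i light_prefix (N + i) [::]))).
  apply: le_hausdorff_pre => x /AL[x01 /(_ N)[k Nk kx]].
  by exists (k - N)%N => //; rewrite subnKC//; split.
apply: le_trans (hausdorff_pre_sigma_subadditive _ _ _) _.
apply: (@le_trans _ _ (\sum_(0 <= i <oo) (th ^+ N * th ^+ i)%:E)%E); last first.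
  by rewrite geometric_nneseries// lee_fin.
apply: lee_nneseries => [i _ _|i _]; first exact: hausdorff_pre_ge0.
apply: le_trans (light_prefix_le _ (erefl : (size [::] + (N + i) = N + i)%N)) _.
  apply: le_trans Nd; apply: ler_wiXn2l; last exact: leq_addr.
  - by rewrite subr_ge0 ltW.
  - by rewrite lerBlDr lerDl ltW.
by rewrite lee_fin /cylinder_length !expr0 !mulr1 exprD.
Qed.
End Cylinders.

End Covering.

(** * Digit averages *)

Section Frequencies.
Context {R : realType}.
Implicit Types (u : nat -> nat) (a b p : R).

Lemma linear_eventually_le0 a b : a < 0 ->
  \forall k \near \oo, a * k%:R + b <= 0.
Proof.
move=> a0; near=> k.
have : b / - a <= k%:R by near: k; exact: nbhs_infty_ger.
by rewrite ler_pdivrMr ?oppr_gt0//; lra.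
Unshelve. all: by end_near. Qed.

(** Clearing the denominator turns limits of averages into inequalities linear in [k], the form used
    below. *)
Lemma cvg_ratioP u p : ((u k)%:R / k%:R : R) @[k --> \oo] --> p <->
  forall e, 0 < e -> \forall k \near \oo, `|(u k)%:R - p * k%:R| <= e * k%:R.
Proof.
have aux e k : (0 < k)%N ->
    (`|p - (u k)%:R / k%:R| <= e) = (`|(u k)%:R - p * k%:R| <= e * k%:R).
  move=> k0; have kR : 0 < k%:R :> R by rewrite ltr0n.
  rewrite distrC -(ler_pM2r kR) -{2}(gtr0_norm kR) -normrM mulrBl divfK//.
  by rewrite gt_eqF.
split=> [/cvgrPdist_le up e e0|up].
  near=> k; rewrite -aux; last by near: k; exact: nbhs_infty_gt.
  by near: k; exact: up.
apply/cvgrPdist_le => e e0; near=> k.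
rewrite aux; last by near: k; exact: nbhs_infty_gt.
by near: k; exact: up.
Unshelve. all: by end_near. Qed.
End Frequencies.

(** * Comparison of two bases *)

Section Dimension.
Context {R : realType}.
Implicit Types (c q r s x : R).

(** The mean of the geometric law giving the digit [j] probability [(1 - q) * q ^+ j]. *)
Definition digit_mean q : R := q / (1 - q).

Definition mean_digit_set c (p : R) : set R :=
  [set x | 0 < x <= 1 /\ (digit_sum c x k)%:R / k%:R @[k --> \oo] --> p].

(** The arguments are real, so that [log_cylinder c 1 p] is the logarithmic length per digit when
    the digits average to [p]. *)
Definition log_cylinder c (k S : R) : R := k * ln (1 - c) + S * ln c.

Lemma cylinder_lengthE c k S : 0 < c < 1 ->
  cylinder_length c k S = expR (log_cylinder c k%:R S%:R).
Proof.
move=> /andP[c0 c1]; rewrite /log_cylinder expRD !expRM_natl !lnK//.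
by rewrite posrE subr_gt0.
Qed.

(** Logarithms turn the hypothesis of [hausdorff_measure_light_cylinders], with [th = expR l], into
    a linear inequality. *)
Lemma light_cylinderE c q s l k S k' S' : 0 < c < 1 -> 0 < q < 1 ->
  (cylinder_length c k S `^ s <= expR l ^+ k * cylinder_length q k' S') =
  (s * log_cylinder c k%:R S%:R <= k%:R * l + log_cylinder q k'%:R S'%:R).
Proof.
move=> c01 q01; rewrite !cylinder_lengthE// -expRM_natl -expRD -expRM ler_expR.
by rewrite mulrC.
Qed.

Lemma ln01_lt0 q : 0 < q < 1 -> ln q < 0 /\ ln (1 - q) < 0.
Proof. by move=> /andP[q0 q1]; rewrite !ln_lt0//; lra. Qed.

Lemma digit_mean_gt0 q : 0 < q < 1 -> 0 < digit_mean q.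
Proof. by move=> /andP[q0 q1]; rewrite divr_gt0// subr_gt0. Qed.

Lemma ln_lt_sub1 (y : R) : 0 < y -> y != 1 -> ln y < y - 1.
Proof.
move=> y0 y1; have h : ln y != 0 by rewrite ln_eq0.
by have := expR_gt1Dx h; rewrite lnK ?posrE//; lra.
Qed.

(** Gibbs' inequality for geometric laws. Multiplied by [1 - q] it becomes the one for two Bernoulli
    laws, which follows from [ln y < y - 1] at [r / q] and at [(1 - r) / (1 - q)]. *)
Lemma gibbs q r : 0 < q < 1 -> 0 < r < 1 -> q != r ->
  log_cylinder r 1 (digit_mean q) < log_cylinder q 1 (digit_mean q).
Proof.
move=> /andP[q0 q1] /andP[r0 r1] qr.
have q'0 : 0 < 1 - q by rewrite subr_gt0.
have r'0 : 0 < 1 - r by rewrite subr_gt0.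
have E y z : (1 - q) * (1 * y + digit_mean q * z) = (1 - q) * y + q * z.
  by rewrite mulrDr mul1r mulrA /digit_mean mulrCA divff ?gt_eqF// mulr1.
rewrite -(ltr_pM2l q'0) /log_cylinder !E.
have := @ln_lt_sub1 (r / q) (divr_gt0 r0 q0).
rewrite ln_div ?posrE// => h1.
have := @ln_lt_sub1 ((1 - r) / (1 - q)) (divr_gt0 r'0 q'0).
rewrite ln_div ?posrE// => h2.
have {}h1 : ln r - ln q < r / q - 1.
  by apply: h1; apply: contra_neq qr => /divr1_eq ->.
have {}h2 : ln (1 - r) - ln (1 - q) < (1 - r) / (1 - q) - 1.
  by apply: h2; apply: contra_neq qr => /divr1_eq; lra.
rewrite -(ltr_pM2l q0) in h1; rewrite -(ltr_pM2l q'0) in h2.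
move: h1 h2; rewrite !mulrBr !(mulrC _ (_ / _)) !divfK ?gt_eqF//; lra.
Qed.

(* Chernoff's bound by a change of base: if the digits of a point average on
   the side of [digit_mean r] away from [digit_mean q], its cylinders are
   exponentially shorter in base [q] than in base [r]. *)
Lemma hausdorff_measure_large_deviation q r (A : set R) :
  0 < q < 1 -> 0 < r < 1 -> q != r ->
  (forall x, A x -> 0 < x <= 1 /\ forall K, exists2 k, (K <= k)%N &
    ((digit_sum q x k)%:R - digit_mean r * k%:R) * (ln q - ln r) <= 0) ->
  hausdorff_measure 1 A = 0%E.
Proof.
move=> q01 r01 qr AP.
(* [l] is the exponential rate at digit average exactly [digit_mean r]; any other digit sum adds the
   product in the hypothesis, which is at most 0. *)
pose l := log_cylinder q 1 (digit_mean r) - log_cylinder r 1 (digit_mean r).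
have l0 : l < 0 by rewrite subr_lt0 gibbs// eq_sym.
apply: (@hausdorff_measure_light_cylinders R q r (expR l)) => //.
  by rewrite expR_gt0 expR_lt1.
move=> x /AP[x01 xP]; split=> // K; have [k Kk kx] := xP K; exists k => //.
rewrite light_cylinderE// mul1r /l /log_cylinder.
by move: kx; move: (ln _) (ln _) (ln _) (ln _) (digit_mean r) => *; lra.
Qed.

End Dimension.

(** * The law of large numbers for digits *)

Section LawOfLargeNumbers.
Context {R : realType}.
Implicit Types (q r a x : R).

Let base_of_mean (a : R) := a / (1 + a).

Let base_of_mean01 a : 0 < a -> 0 < base_of_mean a < 1.
Proof.
move=> a0; have a1 : 0 < 1 + a by rewrite addr_gt0.
by rewrite divr_gt0//= ltr_pdivrMr// mul1r ltrDr.
Qed.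

Let base_of_meanK a : 0 < a -> digit_mean (base_of_mean a) = a.
Proof.
move=> a0; rewrite /digit_mean /base_of_mean.
have a1 : 1 + a != 0 by rewrite gt_eqF// addr_gt0.
by field; rewrite a1 (_ : 1 + a - a = 1) ?oner_neq0//; ring.
Qed.

Let base_of_mean_lt a b : 0 < a -> a < b -> base_of_mean a < base_of_mean b.
Proof.
move=> a0 ab; have b0 := lt_trans a0 ab.
rewrite /base_of_mean ltr_pdivrMr ?addr_gt0// mulrAC ltr_pdivlMr ?addr_gt0//.
by nra.
Qed.

Let digit_meanK q : 0 < q < 1 -> base_of_mean (digit_mean q) = q.
Proof.
move=> /andP[q0 q1]; rewrite /digit_mean /base_of_mean.
have q2 : 1 - q != 0 by rewrite subr_eq0 gt_eqF.
by field; rewrite q2 (_ : 1 - q + q = 1) ?oner_neq0//; ring.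
Qed.

(** If the averages do not tend to [m], then for some [n] they are at least [m + e n], or at most
    [m - e n], at arbitrarily late times. Each of these countably many events is a large deviation,
    for the base whose mean is the threshold. *)
Lemma digit_law_of_large_numbers q : 0 < q < 1 ->
  hausdorff_pre 1 1
    ([set x : R | 0 < x <= 1] `\` mean_digit_set q (digit_mean q)) = 0%E.
Proof.
move=> q01; have m0 := digit_mean_gt0 q01; set m := digit_mean q in m0 *.
(* The sign of [ln q - ln r] selects the side: averages at least [digit_mean r] if [q < r], at most
   [digit_mean r] if [r < q]. *)
pose dev r := [set x : R | 0 < x <= 1 /\ forall K, exists2 k, (K <= k)%N &
  ((digit_sum q x k)%:R - digit_mean r * k%:R) * (ln q - ln r) <= 0].
have dev0 r : 0 < r < 1 -> q != r -> hausdorff_pre 1 1 (dev r) = 0%E.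
  move=> r01 qr.
  suff /hausdorff_measure_eq0 : hausdorff_measure 1 (dev r) = 0%E by apply.
  exact: (@hausdorff_measure_large_deviation R q r).
(* The denominator starts at 2 to keep [m - e n] positive, hence the mean of some base. *)
pose e n : R := m / n.+2%:R.
have e0 n : 0 < e n by rewrite divr_gt0.
have em n : e n < m by rewrite ltr_pdivrMr// ltr_pMr// ltr1n.
have hi n : base_of_mean m < base_of_mean (m + e n).
  by rewrite base_of_mean_lt// ltrDl.
have lo n : base_of_mean (m - e n) < base_of_mean m.
  by rewrite base_of_mean_lt// ?subr_gt0// ltrBlDr ltrDl.
rewrite digit_meanK// in hi lo.
apply/eqP; rewrite eq_le hausdorff_pre_ge0 andbT.
have <- : hausdorff_pre 1 1 (\bigcup_n dev (base_of_mean (m + e n)) `|`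
                       \bigcup_n dev (base_of_mean (m - e n))) = 0%E.
  apply: hausdorff_preU_eq0; apply: hausdorff_pre_bigcup_eq0 => n; apply: dev0.
  - by rewrite base_of_mean01// addr_gt0.
  - by rewrite lt_eqF.
  - by rewrite base_of_mean01// subr_gt0.
  - by rewrite gt_eqF.
apply: le_hausdorff_pre => x [x01 nx]; apply: contrapT => ndev; apply: nx; split=> //.
apply/cvg_ratioP => d d0.
have [n nd] : exists n, e n <= d.
  exists (Num.bound (m / d)); rewrite ler_pdivrMr// mulrC -ler_pdivrMr//.
  apply/ltW/(lt_le_trans (archi_boundP _)); first by rewrite divr_ge0// ltW.
  by rewrite ler_nat leqW.
have nhi : ~ dev (base_of_mean (m + e n)) x.
  by move=> h; apply: ndev; left; exists n.
have nlo : ~ dev (base_of_mean (m - e n)) x.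
  by move=> h; apply: ndev; right; exists n.
have [K1 hK1] : exists K, forall k, (K <= k)%N -> (digit_sum q x k)%:R <= (m + e n) * k%:R.
  apply: contrapT => h; apply: nhi; split=> // K.
  apply: contrapT => h'; apply: h; exists K => k Kk.
  rewrite leNgt; apply/negP => h''; apply: h'; exists k => //.
  rewrite base_of_meanK ?addr_gt0// nmulr_lle0 ?subr_ge0 ?(ltW h'')//.
  have /andP[a0 _] := base_of_mean01 (addr_gt0 m0 (e0 n)).
  by have /andP[q0 _] := q01; rewrite subr_lt0 ltr_ln ?posrE.
have [K2 hK2] : exists K, forall k, (K <= k)%N -> (m - e n) * k%:R <= (digit_sum q x k)%:R.
  apply: contrapT => h; apply: nlo; split=> // K.
  apply: contrapT => h'; apply: h; exists K => k Kk.
  have men : 0 < m - e n by rewrite subr_gt0.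
  rewrite leNgt; apply/negP => h''; apply: h'; exists k => //.
  rewrite base_of_meanK// pmulr_lle0 ?subr_le0 ?(ltW h'')//.
  by rewrite subr_gt0 ltr_ln ?posrE ?lo//; have /andP[] := q01; have /andP[] := base_of_mean01 men.
near=> k.
have k1 : (K1 <= k)%N by near: k; exact: nbhs_infty_ge.
have k2 : (K2 <= k)%N by near: k; exact: nbhs_infty_ge.
have k0 : 0 <= k%:R :> R by [].
have := hK1 _ k1; have := hK2 _ k2; have := ler_wpM2r k0 nd.
by rewrite ler_norml; lra.
Unshelve. all: by end_near. Qed.

End LawOfLargeNumbers.

(** * Dimension of the sets of given digit mean *)

Section DimensionOfLevelSets.
Context {R : realType}.
Implicit Types (c q s x : R).

(** The entropy of the geometric law of base [q] divided by the mean logarithmic expansion of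
    [full_branch] in base [c], both with a minus sign. *)
Definition level_dim c q : R :=
  log_cylinder q 1 (digit_mean q) / log_cylinder c 1 (digit_mean q).

Lemma log_cylinder_lt0 c (S : R) : 0 < c < 1 -> 0 <= S -> log_cylinder c 1 S < 0.
Proof.
move=> /ln01_lt0[lc lc']; rewrite /log_cylinder mul1r => S0.
have := mulr_ge0_le0 S0 (ltW lc); lra.
Qed.

Lemma level_dim_gt0 c q : 0 < c < 1 -> 0 < q < 1 -> 0 < level_dim c q.
Proof.
move=> c01 q01; have m0 := ltW (digit_mean_gt0 q01).
by rewrite /level_dim ltr_ndivlMr ?mul0r log_cylinder_lt0.
Qed.

(** At digit average [m], the [s]-th power of the length in base [c] is smaller than the length in
    base [q] by the factor [expR (- k0)] per digit, with [k0 > 0]. Half of [k0] is given up to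
    absorb the deviation of the average from [m]. *)
Lemma hausdorff_measure_mean_digit_gt c q s : 0 < c < 1 -> 0 < q < 1 ->
  level_dim c q < s -> hausdorff_measure s (mean_digit_set c (digit_mean q)) = 0%E.
Proof.
move=> c01 q01 Ds; have s0 : 0 < s := lt_trans (level_dim_gt0 c01 q01) Ds.
have m0 := digit_mean_gt0 q01; set m := digit_mean q in m0 *.
have [lc lc'] := ln01_lt0 c01; have [lq lq'] := ln01_lt0 q01.
pose k0 := log_cylinder q 1 m - s * log_cylinder c 1 m.
have k00 : 0 < k0.
  rewrite subr_gt0; move: Ds; rewrite /level_dim ltr_ndivrMr//.
  by rewrite log_cylinder_lt0// ltW.
apply: (@hausdorff_measure_light_cylinders R c q (expR (- k0 / 2))) => //.
- by rewrite expR_gt0 expR_lt1 mulNr oppr_lt0 divr_gt0.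
- exact: ltW.
move=> x [x01 /cvg_ratioP xm]; split=> // K.
(* [b] bounds the absolute value of [s * ln c - ln q], the effect of one unit in the digit sum; [e]
   makes a deviation of [e * k] cost at most [k0 / 2 * k]. *)
pose b := - (s * ln c + ln q).
have b0 : 0 < b by rewrite oppr_gt0 -(addr0 0) ltrD// pmulr_rlt0.
pose e := k0 / (2 * b).
have e0 : 0 < e by rewrite divr_gt0// mulr_gt0.
near \oo => k; exists k; first by near: k; exact: nbhs_infty_ge.
rewrite light_cylinderE//.
have : `|(digit_sum c x k)%:R - m * k%:R| <= e * k%:R by near: k; exact: xm.
have eb : e * b = k0 / 2.
  by rewrite /e invfM !mulrA mulfVK// gt_eqF.
move: (digit_sum c x k) => S /(ler_wpM2r (ltW b0)); rewrite (mulrAC e) eb => dev.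
have h : (S%:R - m * k%:R) * (s * ln c - ln q) <= k0 / 2 * k%:R.
  apply: le_trans dev; apply: le_trans (ler_norm _) _.
  rewrite normrM; apply: ler_wpM2l => //; rewrite ler_norml /b.
  have : s * ln c < 0 by rewrite pmulr_rlt0.
  by move: lq; move: (s * _) (ln q) => *; lra.
move: h; rewrite /k0 /log_cylinder.
by move: (ln _) (ln _) (ln _) (ln _) => *; lra.
Unshelve. all: by end_near. Qed.

Lemma hausdorff_measure_mean_digit_lt c q s : 0 < c < 1 -> 0 < q < 1 ->
  0 <= s < level_dim c q ->
  hausdorff_measure s (mean_digit_set c (digit_mean q)) <> 0%E.
Proof.
move=> c01 q01 /andP[s0 sD] null.
have m0 := digit_mean_gt0 q01; set m := digit_mean q in m0 *.
have [lc lc'] := ln01_lt0 c01; have [lq lq'] := ln01_lt0 q01.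
(* The bound of [dist_first_diff] for the distance from [x] to a point that shares its first [k]
   digits and has a larger next one. On [E n] this bound yields the Hoelder inequality with constant
   [n.+1]. *)
pose small (x : R) k := cylinder_length c k.+1 (digit_sum c x k.+2).+1.
pose E n := [set x | [/\ 0 < x <= 1,
    mean_digit_set c m x & forall k,
    cylinder_length q k (digit_sum c x k) <= n.+1%:R * small x k `^ s]].
have EL x : mean_digit_set c m x -> exists n, E n x.
  move=> xm; have [x01 /cvg_ratioP xlim] := xm.
  have smallE k : 0 < small x k `^ s by rewrite powR_gt0// cylinder_length_gt0.
  pose k0 := s * log_cylinder c 1 m - log_cylinder q 1 m.
  have k00 : 0 < k0.
    rewrite subr_gt0; move: sD; rewrite /level_dim -/m ltr_ndivlMr//.
    by rewrite log_cylinder_lt0// ltW.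
  pose b := - (s * ln c + ln q).
  have slc : s * ln c <= 0 by rewrite mulr_ge0_le0// ltW.
  have b0 : 0 < b by move: lq slc; rewrite /b; move: (s * _) => *; lra.
  have [N NP] : exists N, forall k, (N <= k)%N ->
      cylinder_length q k (digit_sum c x k) <= small x k `^ s.
    pose e := k0 / (2 * b).
    have e0 : 0 < e by rewrite divr_gt0// mulr_gt0.
    have eb : e * b = k0 / 2.
      by rewrite /e invfM !mulrA mulfVK// gt_eqF.
    (* [B] collects the terms independent of [k] that come from the shifted indices in [small]; the
       negative slope [- k0 / 2] outweighs it eventually. *)
    pose B := - s * (ln (1 - c) + (2 * (m + e) + 1) * ln c).
    have k02 : - k0 / 2 < 0 by rewrite mulNr oppr_lt0 divr_gt0.
    have [N _ NP] := filterI (linear_eventually_le0 B k02) (xlim _ e0).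
    exists N => k Nk; have [kB Sk] := NP k Nk.
    have [_ Sk2] : _ /\ _ := NP k.+2 (leq_trans Nk (leq_addl 2 k)).
    rewrite /small !cylinder_lengthE// -expRM ler_expR mulrC.
    move: Sk Sk2; move: (digit_sum c x k) (digit_sum c x k.+2) => S S'.
    rewrite !ler_norml => /andP[Sk _] /andP[_ Sk2].
    have {}Sk : (S%:R - (m - e) * k%:R) * ln q <= 0.
      by apply: mulr_ge0_le0; [move: Sk; lra|exact: ltW].
    have {}Sk2 : 0 <= (S'%:R - (m + e) * k.+2%:R) * (s * ln c).
      by apply: mulr_le0 => //; move: Sk2; lra.
    have ek : e * k%:R * b = k0 / 2 * k%:R by rewrite mulrAC eb.
    move: Sk Sk2 ek kB; rewrite /B /k0 /b /log_cylinder.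
    rewrite -[k.+2%:R]natr1 -[k.+1%:R]natr1 -[S'.+1%:R]natr1.
    clearbody e m; move: (ln _) (ln _) (ln _) (ln _) (k%:R) (S%:R) (S'%:R); move=> *; lra.
  (* From [N] on the quotient is at most 1; before [N] it is one of the summands of [M]. *)
  pose M : R := \sum_(i < N) (cylinder_length q i (digit_sum c x i) / small x i `^ s).
  have M0 : 0 <= M.
    by apply: sumr_ge0 => i _; rewrite divr_ge0 ?(ltW (smallE _))// ltW// cylinder_length_gt0.
  exists (Num.bound M); split=> // k; rewrite -ler_pdivrMr//.
  have [Nk|kN] := leqP N k.
    rewrite (@le_trans _ _ 1)// ?ler1n//.
    by rewrite ler_pdivrMr// mul1r NP.
  apply/ltW/(le_lt_trans (y := M)).
    rewrite /M (bigD1 (Ordinal kN))//= lerDl; apply: sumr_ge0 => i _.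
    by rewrite divr_ge0 ?(ltW (smallE _))// ltW// cylinder_length_gt0.
  by apply: lt_le_trans (archi_boundP M0) _; rewrite ler_nat.
pose H n := [set y | 0 < y <= 1 /\ exists2 x, E n x & digit c x =1 digit q y].
have H0 n : hausdorff_pre 1 1 (H n) = 0%E.
  apply/eqP; rewrite eq_le hausdorff_pre_ge0 andbT.
  have <- : (n.+1%:R%:E * hausdorff_pre s 1 (E n) = 0)%E.
    move/hausdorff_measure_eq0 : null => /(_ _ ltr01) null.
    suff -> : hausdorff_pre s 1 (E n) = 0%E by rewrite mule0.
    apply/eqP; rewrite eq_le hausdorff_pre_ge0 andbT -null.
    by apply: le_hausdorff_pre => x [].
  apply: (@hausdorff_pre_holder _ _ _ _ _ _
            (fun x y => 0 < y <= 1 /\ digit c x =1 digit q y)) => //.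
    by move=> y [y01 [x Ex xy]]; exists x.
  move=> x y x' y' Ex Ex' _ _ [y01 xy] [y'01 xy'].
  split; last first.
    by move: y01 y'01; rewrite ler_norml; lra.
  have [x01 x'01] : 0 < x <= 1 /\ 0 < x' <= 1 by case: Ex; case: Ex'.
  have [<-|yy'] := eqVneq y y'.
    by rewrite subrr normr0 mulr_ge0// powR_ge0.
  have /ex_minnP[k kP kmin] : exists k, digit c x k != digit c x' k.
    apply/not_existsP => nx; move: yy' => /eqP; apply.
    apply: (digit_inj q01) => // k; rewrite -xy -xy'.
    by have /negP := nx k; rewrite negbK => /eqP.
  have xx' i : (i < k)%N -> digit c x i = digit c x' i.
    by move=> ik; apply/eqP; apply: contraTT ik => /kmin; rewrite -leqNgt.
  have dy : `|y - y'| <= cylinder_length q k (digit_sum q y k).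
    by apply: dist_same_digits_le => // i ik; rewrite -xy -xy' xx'.
  have Sy : digit_sum q y k = digit_sum c x k by apply: eq_bigr => i _; rewrite xy.
  have Sx : digit_sum c x k = digit_sum c x' k.
    by apply: eq_bigr => i _; rewrite xx'.
  apply: (le_trans dy); rewrite Sy.
  (* The bound of [dist_first_diff] is expressed by the point with the smaller digit. Both points
     lie in [E n], so it applies in either order. *)
  move: kP; rewrite neq_ltn => /orP[xlt|xlt].
    have [_ _ /(_ k) h] := Ex; apply: (le_trans h).
    rewrite ler_pM2l// ge0_ler_powR ?nnegrE ?normr_ge0//.
      exact/ltW/cylinder_length_gt0.
    by rewrite distrC; apply: dist_first_diff => // i ik; rewrite xx'.
  have [_ _ /(_ k) h] := Ex'; rewrite Sx; apply: (le_trans h).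
  rewrite ler_pM2l// ge0_ler_powR ?nnegrE ?normr_ge0//.
    exact/ltW/cylinder_length_gt0.
  exact: dist_first_diff.
(* The contradiction: the null sets [H n] and the exceptional set of the law of large numbers would
   cover the whole interval. *)
apply: (@itv01_hausdorff_pre_neq0 R 1); apply/eqP.
rewrite eq_le hausdorff_pre_ge0 andbT.
rewrite -(hausdorff_preU_eq0 (digit_law_of_large_numbers q01)
           (hausdorff_pre_bigcup_eq0 H0)).
apply: le_hausdorff_pre => y; rewrite /= in_itv/= => y01.
have [[_ ym]|ny] := pselect (mean_digit_set q (digit_mean q) y); last by left.
right; pose x := point_of_digits c (digit q y).
have xy := digit_point_of_digits c01 (digit q y).
have xm : mean_digit_set c m x.
  split; first exact: point_of_digits01.
  rewrite (_ : (fun k => _) = (fun k => (digit_sum q y k)%:R / k%:R))//.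
  by apply/funext => k; congr (_%:R / _); apply: eq_bigr => i _; exact: xy.
have [n Ex] := EL _ xm; exists n => //; split=> //.
by exists x.
Qed.

End DimensionOfLevelSets.

(** * The Lyapunov exponent and the queue *)

Section Queue.
Implicit Types (d : nat -> nat).

(* A queue with [d i] arrivals and one service at time [i]; [busy d k] counts
   the services before time [k]. *)
Fixpoint queue d n := if n is m.+1 then (queue d m + d m).-1 else 0%N.

Definition busy d k := (\sum_(i < k) (0 < queue d i + d i))%N.

Lemma busyS d k : busy d k.+1 = (busy d k + (0 < queue d k + d k))%N.
Proof. by rewrite /busy big_ord_recr. Qed.

(** Each customer that has arrived either waits or has been served. *)
Lemma queue_balance d k : (queue d k + busy d k = \sum_(i < k) d i)%N.
Proof.
elim: k => [|k IH]; first by rewrite /busy !big_ord0.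
rewrite busyS big_ord_recr/= -IH.
by have [e|e] := posnP (queue d k + d k); lia.
Qed.

(** The queue loses at most one customer per step, which the induction carries along, so [m] waiting
    customers keep the server busy for [m] steps. *)
Lemma busy_queue d k m : (m <= queue d k)%N -> busy d (k + m) = (busy d k + m)%N.
Proof.
move=> mk; suff [//] : busy d (k + m) = (busy d k + m)%N /\
    (queue d k <= queue d (k + m) + m)%N.
elim: m mk => [|m IH] mk; first by rewrite !addn0.
have [b q] := IH (ltnW mk); rewrite addnS busyS b/=.
split; lia.
Qed.

(* [m] is the time following the last slot before [k] without a service. *)
Lemma busy_last_idle d k : exists2 m, (m <= k)%N &
  (k + \sum_(i < m) d i = busy d k + m)%N.
Proof.
elim: k => [|k [m mk IH]].
  by exists 0%N => //; rewrite /busy !big_ord0.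
have [e|e] := posnP (queue d k + d k); last first.
  by exists m; [exact: leqW|rewrite busyS e addSn IH/=; lia].
exists k.+1 => //; rewrite busyS e addn0 big_ord_recr/= -queue_balance; lia.
Qed.

Context {R : realType}.
Implicit Types p : R.

(** The constant absorbs the early indices. A bound valid at every index is wanted because the time
    given by [busy_last_idle] may stay small as [k] grows. *)
Lemma cvg_ratio_affine_bound (u : nat -> nat) p e : 0 < e ->
  (u k)%:R / k%:R @[k --> \oo] --> p ->
  exists C, forall k, `|(u k)%:R - p * k%:R| <= e * k%:R + C.
Proof.
move=> e0 /cvg_ratioP/(_ _ e0)[N _ NP].
pose f k : R := `|(u k)%:R - p * k%:R|.
have f0 k : 0 <= f k by exact: normr_ge0.
exists (\sum_(i < N) f i) => k; have [Nk|kN] := leqP N k.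
  by rewrite (le_trans (NP _ Nk))// lerDl sumr_ge0.
rewrite (bigD1 (Ordinal kN))//= addrCA lerDl addr_ge0//; last exact: sumr_ge0.
by rewrite mulr_ge0// ltW.
Qed.

Lemma busy_le d k : (busy d k <= \sum_(i < k) d i)%N /\ (busy d k <= k)%N.
Proof.
split; first by rewrite -queue_balance leq_addl.
by rewrite -[leqRHS](card_ord k) -sum1_card; apply: leq_sum => i _; exact: leq_b1.
Qed.

(** The services number at most [k] and at most the arrivals. Conversely, with [m] from
    [busy_last_idle], they number [k - m] plus the arrivals before [m], about [k - m + p * m], and
    this is at least [Num.min p 1 * k]. *)
Lemma busy_freq d p : ((\sum_(i < k) d i)%N)%:R / k%:R @[k --> \oo] --> p ->
  (busy d k)%:R / k%:R @[k --> \oo] --> Num.min p 1.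
Proof.
move=> lim; apply/cvg_ratioP => e e0.
have e2 : 0 < e / 2 by rewrite divr_gt0.
have [C CP] := cvg_ratio_affine_bound e2 lim.
near=> k.
have kC : C <= e / 2 * k%:R.
  rewrite -ler_pdivrMl//; near: k; exact: nbhs_infty_ger.
have /(_ k) := CP; rewrite ler_norml => /andP[_ Sk].
have [m mk bm] := busy_last_idle d k.
have /(_ m) := CP; rewrite ler_norml => /andP[Sm _].
have [b1 b2] := busy_le d k.
move: bm mk b1 b2 Sk Sm; move: (\sum_(i < k) d i)%N (\sum_(i < m) d i)%N => S S'.
move=> /(congr1 (fun n => n%:R : R)); rewrite !natrD.
rewrite -(ler_nat R) -(ler_nat R) -(ler_nat R).
have := ler0n R k; have := ler0n R m.
move: (busy d k)%:R (k%:R) (m%:R) S%:R S'%:R kC => b K M s s' kC M0 K0 bm MK bs bK Sk Sm.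
have eMK : e / 2 * M <= e / 2 * K by rewrite ler_pM2l.
have eK : 0 <= e * K by rewrite mulr_ge0// ltW.
have [p1|p1] := leP p 1; rewrite ler_norml.
  have : 0 <= (1 - p) * (K - M) by rewrite mulr_ge0// subr_ge0.
  lra.
have : 0 <= (p - 1) * M by rewrite mulr_ge0// subr_ge0 ltW.
lra.
Unshelve. all: by end_near. Qed.

(** A long queue at time [k] would make the server busy without a break until [k + queue d k],
    raising the frequency above [p < 1]. So the queue is of smaller order than [k], and by
    [queue_balance] arrivals and services have the same mean. *)
Lemma mean_of_busy_freq d p : 0 <= p < 1 ->
  (busy d k)%:R / k%:R @[k --> \oo] --> p ->
  ((\sum_(i < k) d i)%N)%:R / k%:R @[k --> \oo] --> p.
Proof.
move=> /andP[p0 p1] /cvg_ratioP lim; apply/cvg_ratioP => e e0.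
have p'0 : 0 < 1 - p by rewrite subr_gt0.
(* The estimate is [q <= h * (2 * K + q)]: with [h <= 2^-1] it gives [q <= 4 * h * K], and the fifth
   [h * K] is the error of [b]. *)
pose h := Num.min (2^-1) (e / 5).
pose u := (1 - p) * h.
have h0 : 0 < h by rewrite lt_min invr_gt0 ltr0n divr_gt0.
have u0 : 0 < u by rewrite mulr_gt0.
have h2 : h <= 2^-1 by rewrite ge_min lexx.
have h5 : h <= e / 5 by rewrite ge_min lexx orbT.
have [N _ NP] := lim _ u0.
exists N => // k Nk; have bk := NP k Nk.
have /= := NP (k + queue d k)%N (leq_trans Nk (leq_addr _ _)).
rewrite busy_queue// -queue_balance !natrD; move: bk.
have := ler0n R k; have := ler0n R (queue d k).
move: (queue d k)%:R (busy d k)%:R (k%:R) => q b K q0 K0.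
rewrite !ler_norml => /andP[bk1 bk2] /andP[bq1 bq2].
have : (1 - p) * q <= (1 - p) * (h * (2 * K + q)) by move: bk1 bq2; rewrite /u; lra.
rewrite ler_pM2l// => qK.
have hq : h * q <= 2^-1 * q by rewrite ler_wpM2r.
have hK : h * K <= e / 5 * K by rewrite ler_wpM2r.
have uK : u * K <= h * K by rewrite ler_wpM2r// ler_piMl ?(ltW h0)//; lra.
by apply/andP; split; lra.
Qed.

Section Orbit.
Variable c : R.
Hypothesis c01 : 0 < c < 1.
Implicit Types x : R.

(** Multiplying [y] by [c ^+ q] raises its first digit by [q]. If [j] is the resulting digit, [F]
    returns [full_branch y] times [c ^+ j.-1]: the digit joins the exponent and one power is
    removed, unless there is none, as in the queue. *)
Lemma iter_F x i : 0 < x <= 1 ->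
  iter i (F c) x = c ^+ queue (digit c x) i * iter i (full_branch c) x /\
  branch c (iter i (F c) x) = (queue (digit c x) i + digit c x i).+1.
Proof.
have /andP[c0 c1] := c01; move=> x01.
have br q y : 0 < y <= 1 -> branch c (c ^+ q * y) = (q + (branch c y).-1).+1.
  move=> y01; have [ey gy] := expansion_step c01 y01.
  by rewrite {1}ey mulrA -exprD branch_affine.
have Fq q y : 0 < y <= 1 ->
    F c (c ^+ q * y) = c ^+ (q + (branch c y).-1).-1 * full_branch c y.
  move=> y01; have [ey gy] := expansion_step c01 y01.
  have eqy : c ^+ q * y =
      c ^+ (q + (branch c y).-1) * (c + (1 - c) * full_branch c y).
    by rewrite {1}ey mulrA -exprD.
  rewrite /F br// eqSS eqy; move: (full_branch c y) => z.
  have cn0 : c != 0 by rewrite gt_eqF.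
  have cb0 : 1 - c != 0 by rewrite subr_eq0 gt_eqF.
  move: (q + (branch c y).-1)%N => [|n]/=.
    by rewrite !expr0 !mul1r; field; rewrite cb0.
  by rewrite exprS [c ^+ n.+2]exprSr exprS; field; rewrite cn0 cb0.
suff h : iter i (F c) x = c ^+ queue (digit c x) i * iter i (full_branch c) x.
  by split=> //; rewrite h br ?full_branch01.
elim: i => [|i IH]; first by rewrite /= mul1r.
by rewrite iterS IH Fq ?full_branch01// iterS.
Qed.

(** The slope has the additional factor [c^-1] exactly off [X c 1], that is, by [iter_F], when the
    server is busy. *)
Lemma lyap_avgE x n : 0 < x <= 1 -> (0 < n)%N ->
  lyap_avg c x n = - ln (1 - c) - ((busy (digit c x) n)%:R / n%:R) * ln c.
Proof.
have /andP[c0 c1] := c01; move=> x01 n0.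
have cb0 : 0 < 1 - c by rewrite subr_gt0.
have E i : ln `|F' c (iter i (F c) x)| =
    - ln (1 - c) - (0 < queue (digit c x) i + digit c x i)%N%:R * ln c.
  rewrite /F' (iter_F i x01).2 eqSS; case: (_ + _)%N => [|k]/=.
    by rewrite gtr0_norm ?invr_gt0// lnV ?posrE// mul0r subr0.
  rewrite gtr0_norm ?invr_gt0 ?mulr_gt0// lnV ?posrE ?mulr_gt0//.
  by rewrite lnM ?posrE//; lra.
rewrite /lyap_avg big_mkord; under eq_bigr do rewrite E.
rewrite sumrB big_const_ord.
rewrite iter_addr addr0 -mulr_suml -natr_sum -/(busy _ _) mulrBr.
have nn0 : n%:R != 0 :> R by rewrite pnatr_eq0 -lt0n.
by rewrite -[X in _ * X - _]mulr_natl; field.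
Qed.

Lemma lyap_avg_cvg x p : 0 < x <= 1 ->
  lyap_avg c x @ \oo --> - ln (1 - c) - p * ln c <->
  (busy (digit c x) k)%:R / k%:R @[k --> \oo] --> p.
Proof.
move=> x01; have [lc _] := ln01_lt0 c01.
have E : {near \oo, (fun k => - ln (1 - c) -
    ((busy (digit c x) k)%:R / k%:R) * ln c) =1 lyap_avg c x}.
  by exists 1%N => // k k1; rewrite /= lyap_avgE.
split=> h; last first.
  apply: cvg_trans; first exact: (near_eq_cvg E).
  by apply: cvgB; [exact: cvg_cst|exact: cvgMl].
have {}h : - ln (1 - c) - (busy (digit c x) k)%:R / k%:R * ln c @[k --> \oo] -->
    - ln (1 - c) - p * ln c.
  apply: cvg_trans h; apply: near_eq_cvg.
  by apply: filterS E => k ->.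
have -> : p = (- ln (1 - c) - (- ln (1 - c) - p * ln c)) * (ln c)^-1.
  by rewrite opprB addrCA subrr addr0 mulfK// lt_eqF.
rewrite (_ : (fun k => _) = (fun k => (- ln (1 - c) -
    (- ln (1 - c) - (busy (digit c x) k)%:R / k%:R * ln c)) * (ln c)^-1)); last first.
  by apply/funext => k; rewrite opprB addrCA subrr addr0 mulfK// lt_eqF.
by apply: cvgMl; apply: cvgB; [exact: cvg_cst|].
Qed.

Lemma J_mean_digit_set p : 0 <= p < 1 ->
  J c (- ln (1 - c) - p * ln c) = mean_digit_set c p.
Proof.
move=> /[dup] p01 /andP[p0 p1]; apply/seteqP; split=> x [x01 h]; split=> //.
  by apply: (mean_of_busy_freq p01); exact/lyap_avg_cvg.
by apply/lyap_avg_cvg => //; have := busy_freq h; rewrite min_l// ltW.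
Qed.

Lemma mean_digit_set_sub_J p : 1 <= p ->
  mean_digit_set c p `<=` J c (- ln (1 - c) - ln c).
Proof.
move=> p1 x [x01 h]; split=> //; rewrite -[X in _ - X]mul1r.
by apply/lyap_avg_cvg => //; have := busy_freq h; rewrite min_r.
Qed.

Lemma lyap_avg_bounds x n : 0 < x <= 1 -> (0 < n)%N ->
  - ln (1 - c) <= lyap_avg c x n <= - ln (1 - c) - ln c.
Proof.
move=> x01 n0; have [lc _] := ln01_lt0 c01; rewrite lyap_avgE//.
have nR : 0 < n%:R :> R by rewrite ltr0n.
have [_ bn] := busy_le (digit c x) n.
have b1 : (busy (digit c x) n)%:R / n%:R <= 1 :> R.
  by rewrite ler_pdivrMr// mul1r ler_nat.
have b0 : 0 <= (busy (digit c x) n)%:R / n%:R :> R by rewrite divr_ge0.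
move: (_ / _) b0 b1 => b b0 b1; have [lc0 bl] := (ltW lc, mulr_ge0_le0 b0 (ltW lc)).
by have := ler_wnM2r lc0 b1; rewrite mul1r => bl1; apply/andP; split; lra.
Qed.
End Orbit.
End Queue.

(** * Real analytic functions *)

Section Analytic.
Context {R : realType}.
Implicit Types (f g : R -> R) (x u v : R) (a b : R^nat).

Lemma real_analytic_at_near f g x0 : (\forall x \near x0, f x = g x) ->
  real_analytic_at f x0 -> real_analytic_at g x0.
Proof.
move=> /nbhs_ballP[d /= d0 fg] [a [r [r0 ar]]].
exists a, (Num.min d r); split; first by rewrite lt_min d0.
move=> x; rewrite lt_min => /andP[xd xr]; rewrite -fg; first exact: ar.
by rewrite /ball/= distrC.
Qed.

Lemma eq_real_analytic_at f g x0 :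
  f =1 g -> real_analytic_at f x0 -> real_analytic_at g x0.
Proof. by move=> /funext->. Qed.

Lemma real_analytic_atD f g x0 : real_analytic_at f x0 ->
  real_analytic_at g x0 -> real_analytic_at (fun x => f x + g x) x0.
Proof.
move=> [a [r [r0 ar]]] [b [s [s0 bs]]].
exists (fun n => a n + b n), (Num.min r s); split; first by rewrite lt_min r0.
move=> x; rewrite lt_min => /andP[xr xs].
rewrite (_ : pseries _ _ =
    (fun n => pseries a (x - x0) n + pseries b (x - x0) n)); last first.
  apply/funext => n; rewrite /pseries /series/= -big_split/=.
  by apply: eq_bigr => i _; rewrite mulrDl.
by apply: cvgD; [exact: ar|exact: bs].
Qed.

Lemma real_analytic_atZ f x0 k : real_analytic_at f x0 ->
  real_analytic_at (fun x => k * f x) x0.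
Proof.
move=> [a [r [r0 ar]]]; exists (fun n => k * a n), r; split=> // x xr.
rewrite (_ : pseries _ _ = (fun n => k * pseries a (x - x0) n)); last first.
  apply/funext => n; rewrite /pseries /series/= mulr_sumr.
  by apply: eq_bigr => i _; rewrite mulrA.
by apply: cvgMr; exact: ar.
Qed.

(** Write the factor as [x0 + (x - x0)]; its second summand shifts the coefficients. *)
Lemma real_analytic_at_mulX f x0 : real_analytic_at f x0 ->
  real_analytic_at (fun x => x * f x) x0.
Proof.
move=> [a [r [r0 ar]]].
exists (fun n => x0 * a n + (if n is m.+1 then a m else 0)), r; split=> // x xr.
rewrite -cvg_shiftS; set y := x - x0.
rewrite (_ : (fun n => _) =
    (fun n => x0 * pseries a y n.+1 + y * pseries a y n)); last first.
  apply/funext => n; rewrite /pseries /series/= mulr_sumr mulr_sumr.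
  under eq_bigr do rewrite mulrDl.
  rewrite big_split/=; congr (_ + _); first by apply: eq_bigr => i _; rewrite mulrA.
  rewrite big_nat_recl//= mul0r add0r; apply: eq_bigr => i _.
  by rewrite exprS mulrCA.
rewrite (_ : x * f x = x0 * f x + y * f x); last by rewrite -mulrDl /y addrC subrK.
apply: cvgD; apply: cvgMr; last exact: ar.
by rewrite (cvg_shiftS (pseries a y)); exact: ar.
Qed.

Lemma real_analytic_at_divX f x0 : x0 != 0 -> real_analytic_at f x0 ->
  real_analytic_at (fun x => f x / x) x0.
Proof.
move=> x00 [a [r [r0 ar]]].
(* The coefficients that result from dividing the series by [x0 + (x - x0)]. *)
pose b := fix b n := if n is m.+1 then (a m.+1 - b m) / x0 else a 0%N / x0.
have nx0 : 0 < `|x0| by rewrite normr_gt0.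
pose h := Num.min r `|x0| / 2.
have m0 : 0 < Num.min r `|x0| by rewrite lt_min r0.
have h0 : 0 < h by rewrite divr_gt0.
have hr : h < r.
  by rewrite /h ltr_pdivrMr// gt_min mulr2n mulrDr mulr1 ltrDl r0.
have hx : h < `|x0|.
  by rewrite /h ltr_pdivrMr// gt_min mulr2n mulrDr mulr1 [X in _ || X]ltrDl nx0 orbT.
clearbody h.
have [M [M0 Mh]] : exists M, 0 < M /\ forall n, `|a n| * h ^+ n <= M.
  have : cvgn (pseries a h).
    apply/cvg_ex; exists (f (x0 + h)).
    by have := ar (x0 + h); rewrite addrAC subrr add0r gtr0_norm//; apply.
  move=> /cvg_series_cvg_0/cvgP/cvg_seq_bounded[M [_ MP]].
  exists (`|M| + 1); split; first by rewrite ltr_wpDl.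
  move=> n; rewrite -(gtr0_norm h0) -normrX -normrM; apply: MP => //.
  by rewrite ltr_pwDr// ler_norm.
(* [K] solves M + h K = |x0| K, which closes the induction in [bK]. *)
pose K := M / (`|x0| - h).
have xh : 0 < `|x0| - h by rewrite subr_gt0.
have MK : M = K * (`|x0| - h) by rewrite /K divfK// gt_eqF.
have K0 : 0 < K by rewrite divr_gt0.
have bK n : `|b n| * h ^+ n <= K.
  elim: n => [|n IH] /=.
    rewrite mulr1 normrM normfV ler_pdivrMr//.
    have := Mh 0%N; rewrite mulr1 => /le_trans; apply.
    by rewrite MK ler_pM2l// gerBl ltW.
  rewrite normrM normfV mulrAC ler_pdivrMr//.
  apply: (@le_trans _ _ ((`|a n.+1| + `|b n|) * h ^+ n.+1)).
    by rewrite ler_pM2r ?exprn_gt0// ler_normB.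
  rewrite mulrDl; apply: (@le_trans _ _ (M + h * K)).
    apply: lerD; first exact: Mh.
    by rewrite exprS mulrCA ler_pM2l.
  by rewrite MK; lra.
exists b, h; split=> // x xx0; set y := x - x0 in xx0 *.
have x_neq0 : x != 0.
  rewrite -normr_gt0 (_ : x = x0 + y); last by rewrite /y addrC subrK.
  rewrite (lt_le_trans _ (lerB_normD _ _))// subr_gt0.
  exact: lt_trans xx0 hx.
have bx n : x0 * b n.+1 = a n.+1 - b n by rewrite /= mulrC divfK.
(* The product of [x] with a partial sum telescopes up to one boundary term, which tends to 0 by the
   bound [bK]. *)
have E n : x * pseries b y n.+1 = pseries a y n.+1 + b n * y ^+ n.+1.
  have ex : x = x0 + y by rewrite /y addrC subrK.
  elim: n => [|n IH].
    rewrite /pseries /series/= !big_nat1 !expr0 expr1 !mulr1 ex mulrDl mulrC divfK//.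
    by rewrite [y * _]mulrC.
  rewrite {1}/pseries /series/= big_nat_recr//= -/(series _ _) mulrDr.
  rewrite -[X in x * X + _]/(pseries b y n.+1) IH.
  rewrite [in RHS]/pseries /series/= [in RHS]big_nat_recr//= -/(series _ _).
  rewrite -[X in _ = X + _ + _]/(pseries a y n.+1).
  have := bx n; rewrite /= => bn; rewrite ex [y ^+ n.+2]exprS mulrA mulrDl bn.
  by ring.
have lim0 : b n * y ^+ n.+1 @[n --> \oo] --> 0.
  apply/norm_cvg0P; apply: (@squeeze_cvgr _ _ _ _ (fun=> 0)
    (fun n => K * (`|y| * (`|y| / h) ^+ n))).
  - apply: nearW => n; rewrite normr_ge0/= normrM normrX.
    rewrite [leLHS](_ : _ = (`|b n| * h ^+ n) * (`|y| * (`|y| / h) ^+ n)).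
      by rewrite ler_wpM2r// mulr_ge0// exprn_ge0// divr_ge0// ltW.
    have hn : h ^+ n != 0 by rewrite expf_neq0// gt_eqF.
    rewrite exprS exprMn exprVn.
    by move: (h ^+ n) hn (`|y| ^+ n) `|y| `|b n| => u u0 v w z; field.
  - exact: cvg_cst.
  - rewrite -[X in _ --> X](mulr0 K) -[X in _ --> K * X](mulr0 `|y|).
    apply: cvgMr; apply: cvgMr; apply: cvg_expr.
    by rewrite ger0_norm ?divr_ge0 ?(ltW h0)// ltr_pdivrMr// mul1r.
rewrite -cvg_shiftS.
rewrite (_ : (fun n => _) =
    (fun n => (pseries a y n.+1 + b n * y ^+ n.+1) * x^-1)); last first.
  by apply/funext => n; rewrite -E mulrAC divff// mul1r.
apply: cvgMl; rewrite -[f x]addr0; apply: cvgD => //.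
by rewrite (cvg_shiftS (pseries a y)); apply: ar; exact: lt_trans xx0 hr.
Qed.

Let ln_coef n : R := if n is m.+1 then (-1) ^+ m / m.+1%:R else 0.

Let is_derive_ln_series n (t : R) : 1 + t != 0 ->
  is_derive t (1 : R) (fun z => pseries ln_coef z n.+1) ((1 - (- t) ^+ n) / (1 + t)).
Proof.
move=> t1; elim: n => [|n IH].
  rewrite expr0 subrr mul0r (_ : (fun z => _) = cst 0); first exact: is_derive_cst.
  by apply/funext => z; rewrite /pseries /series/= big_nat1 mul0r.
rewrite (_ : (fun z => _) = (fun z => pseries ln_coef z n.+1) \+
    (fun z => ln_coef n.+1 * z ^+ n.+1)); last first.
  by apply/funext => z; rewrite /pseries /series/= big_nat_recr.
have h : is_derive t (1 : R) (fun z => ln_coef n.+1 * z ^+ n.+1) ((- t) ^+ n).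
  rewrite (_ : (fun z => _) = ln_coef n.+1 *: (id : R -> R) ^+ n.+1); last first.
    by apply/funext => z; rewrite fctE.
  apply: is_derive_eq; rewrite /= /GRing.scale/= mulr1.
  by rewrite mulrA divfK ?pnatr_eq0// -exprMn mulN1r.
apply: is_derive_eq; rewrite exprS; field.
by [].
Qed.

(** The mean value theorem for the remainder [g], whose derivative is [- ((- t) ^+ n / (1 + t))];
    the factor 2 comes from [1 + t > 2^-1]. *)
Let ln_series_le (z : R) n : `|z| < 2^-1 ->
  `|pseries ln_coef z n.+1 - ln (1 + z)| <= 2 * `|z| ^+ n.+1.
Proof.
move=> z2.
pose g w := pseries ln_coef w n.+1 - ln (1 + w).
have zt (t : R) : `|t| <= `|z| -> 2^-1 < 1 + t.
  by move=> tz; have := ler_norml t `|z|; rewrite tz => /esym/andP[]; lra.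
have dg t : `|t| <= `|z| -> is_derive t (1 : R) g (- ((- t) ^+ n / (1 + t))).
  move=> /zt t1; have t0 : 0 < 1 + t by lra.
  have h1 := is_derive_ln_series n (lt0r_neq0 t0).
  have h2 : is_derive t (1 : R) (fun w => ln (1 + w)) ((1 + t)^-1).
    have h := is_derive1_ln t0.
    apply: (@is_derive_eq _ _ _ _ _ _ _ _ (is_derive1_comp h _)).
    by rewrite add0r mulr1.
  apply: (@is_derive_eq _ _ _ _ _ _ _ _ (is_deriveB h1 h2)).
  by field; rewrite gt_eqF.
have g0 : g 0 = 0.
  rewrite /g addr0 ln1 subr0 /pseries /series/= big_nat_recl//= mul0r add0r.
  by apply: big1 => i _; rewrite expr0n mulr0.
have [d dz gz] : exists2 d, `|d| <= `|z| & g z = - ((- d) ^+ n / (1 + d)) * z.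
  have cg u v : (forall t, t \in `[u, v] -> `|t| <= `|z|) ->
      {within `[u, v], continuous g}.
    move=> uv; apply: derivable_within_continuous => t /uv tz.
    by have [] := dg t tz.
  have [z0|z0] := leP 0 z.
    have h t : t \in `[0, z] -> `|t| <= `|z|.
      by rewrite in_itv/= => /andP[t0 tz]; rewrite !ger0_norm.
    have hd t : t \in `]0, z[ -> is_derive t (1 : R) g (- ((- t) ^+ n / (1 + t))).
      by move=> tz; apply: dg; apply: h; exact: subset_itv_oo_cc.
    have [d dz gd] := MVT_segment z0 hd (cg _ _ h).
    exists d; first exact: h.
    by move: gd; rewrite g0 !subr0.
  have h t : t \in `[z, 0] -> `|t| <= `|z|.
    rewrite in_itv/= => /andP[zt' t0].
    by rewrite !ler0_norm ?lerN2// ltW.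
  have hd t : t \in `]z, 0[ -> is_derive t (1 : R) g (- ((- t) ^+ n / (1 + t))).
    by move=> tz; apply: dg; apply: h; exact: subset_itv_oo_cc.
  have [d dz gd] := MVT_segment (ltW z0) hd (cg _ _ h).
  exists d; first exact: h.
  by move: gd; rewrite g0 !sub0r mulrN => /oppr_inj.
rewrite -/(g z) gz normrM normrN normrM normfV normrX normrN.
have d1 := zt d dz; have d0 : 0 < 1 + d by lra.
rewrite (gtr0_norm d0) exprSr mulrA ler_wpM2r//.
rewrite ler_pdivrMr// (@le_trans _ _ (`|z| ^+ n))//; first by rewrite lerXn2r ?nnegrE.
have : 1 <= 2 * (1 + d) by lra.
by move=> /(ler_wpM2r (exprn_ge0 n (normr_ge0 z))); rewrite mul1r mulrAC.
Qed.

Lemma real_analytic_at_ln_affine u v x0 : 0 < u * x0 + v ->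
  real_analytic_at (fun x => ln (u * x + v)) x0.
Proof.
set w := u * x0 + v => w0.
pose a n : R := if n is m.+1 then ln_coef n * (u / w) ^+ n else ln w.
have u1 : 0 < `|u| + 1 by rewrite ltr_wpDl.
(* This radius keeps [z] below [2^-1] in absolute value; the summand 1 covers [u = 0]. *)
exists a, (w / (2 * (`|u| + 1))); split.
  by rewrite divr_gt0// mulr_gt0.
move=> x; set y := x - x0; rewrite ltr_pdivlMr ?mulr_gt0// => yw.
pose z := u / w * y.
have z2 : `|z| < 2^-1.
  rewrite /z normrM normrM normfV (gtr0_norm w0) mulrAC ltr_pdivrMr//.
  by have := normr_ge0 y; lra.
have -> : ln (u * x + v) = ln w + ln (1 + z).
  have z1 : 0 < 1 + z by move: z2; rewrite ltr_norml => /andP[]; lra.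
  rewrite -lnM ?posrE//; congr ln.
  by rewrite /z /y /w; field; rewrite gt_eqF.
rewrite -cvg_shiftS.
rewrite (_ : (fun n => _) = (fun n => ln w + pseries ln_coef z n.+1)); last first.
  apply/funext => n; rewrite /pseries /series/= !big_nat_recl//= mulr1 mul0r add0r.
  by congr (_ + _); apply: eq_bigr => i _; rewrite /z -mulrA -exprMn.
apply: cvgD; first exact: cvg_cst.
apply/cvgrPdist_le => e e0.
have /cvgrPdist_le/(_ _ e0) : 2 * `|z| ^+ n.+1 @[n --> \oo] --> 0.
  rewrite -[X in _ --> X](mulr0 2); apply: cvgMr.
  rewrite (cvg_shiftS (fun n => `|z| ^+ n)); apply: cvg_expr.
  by rewrite normr_id (lt_trans z2)//; lra.
apply: filterS => n; rewrite sub0r normrN ger0_norm; last by rewrite mulr_ge0// exprn_ge0.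
by apply: le_trans; rewrite distrC; exact: ln_series_le.
Qed.

End Analytic.

(** * The Lyapunov spectrum *)

Section Spectrum.
Context {R : realType}.
Variable c : R.
Hypothesis c_half : 2^-1 < c < 1.
Implicit Types p q a : R.

Let c01 : 0 < c < 1.
Proof. by have /andP[h1 h2] := c_half; apply/andP; split; lra. Qed.

Let lc : ln c < 0. Proof. by have [] := ln01_lt0 c01. Qed.
Let lc' : ln (1 - c) < 0. Proof. by have [] := ln01_lt0 c01. Qed.

Lemma hausdorff_dim_mean_digit_set q : 0 < q < 1 ->
  hausdorff_dim (mean_digit_set c (digit_mean q)) = (level_dim c q)%:E.
Proof.
move=> q01; apply: hausdorff_dim_eq.
- exact/ltW/level_dim_gt0.
- by move=> s; exact: hausdorff_measure_mean_digit_gt.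
- by move=> s; exact: hausdorff_measure_mean_digit_lt.
Qed.

Lemma hausdorff_dim_J p : 0 < p < 1 ->
  hausdorff_dim (J c (- ln (1 - c) - p * ln c)) =
  (((1 + p) * ln (1 + p) - p * ln p) / (- ln (1 - c) - p * ln c))%:E.
Proof.
move=> /andP[p0 p1]; have p'0 : 0 < 1 + p by rewrite addr_gt0.
rewrite J_mean_digit_set ?(ltW p0)//.
pose q := p / (1 + p).
have q01 : 0 < q < 1 by rewrite divr_gt0//= ltr_pdivrMr// mul1r ltrDr.
have q' : 1 - q = (1 + p)^-1.
  by rewrite /q; field; rewrite gt_eqF.
have mq : digit_mean q = p.
  by rewrite /digit_mean q' invrK /q divfK// gt_eqF.
rewrite -{1}mq hausdorff_dim_mean_digit_set// /level_dim /log_cylinder mq q'.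
rewrite lnV ?posrE// ln_div ?posrE// !mul1r; congr (_%:E).
have a0 : ln (1 - c) + p * ln c < 0.
  by rewrite -(addr0 0) ltrD// pmulr_rlt0.
have a0' : - ln (1 - c) - p * ln c != 0 by rewrite -opprD oppr_eq0 lt_eqF.
move: a0 a0'; move: (ln _) (ln _) (ln _) (ln _) => x y z w a0 a0'.
by field; rewrite a0' lt_eqF.
Qed.

(** Base [c] is compared with itself: the power [s - 1] of a length is at most [(1 - c) ^+ k] to
    that power. *)
Lemma hausdorff_measure_J_gt1 a s : 1 < s -> hausdorff_measure s (J c a) = 0%E.
Proof.
move=> s1; have s0 := lt_trans ltr01 s1.
apply: (@hausdorff_measure_light_cylinders R c c (expR ((s - 1) * ln (1 - c)))) => //.
- by rewrite expR_gt0 expR_lt1 pmulr_rlt0// subr_gt0.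
- exact: ltW.
move=> x [x01 _]; split=> // K; exists K => //.
rewrite light_cylinderE// /log_cylinder.
have := mulr_ge0_le0 (ler0n R (digit_sum c x K)) (ltW lc).
rewrite -(pmulr_rle0 (x := s - 1)) ?subr_gt0// => u0.
by move: u0; move: (ln c) (ln (1 - c)) => *; lra.
Qed.

Lemma hausdorff_dim_J_max : hausdorff_dim (J c (- ln (c * (1 - c)))) = 1%E.
Proof.
have /andP[c0 c1] := c01; have cb : 0 < 1 - c by rewrite subr_gt0.
have c2 : 2^-1 < c by case/andP: c_half.
have -> : - ln (c * (1 - c)) = - ln (1 - c) - ln c.
  by rewrite lnM ?posrE// opprD addrC.
apply: hausdorff_dim_eq => // s.
  exact: hausdorff_measure_J_gt1.
move=> s01 /hausdorff_measure_subset_eq0 null.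
apply: (@hausdorff_measure_mean_digit_lt R c c s) => //.
  rewrite /level_dim divff// lt_eqF// log_cylinder_lt0//.
  exact/ltW/digit_mean_gt0.
apply: null; apply: mean_digit_set_sub_J => //.
by rewrite /digit_mean ler_pdivlMr// mul1r; lra.
Qed.

(** The point with constant digits [n]; the values 0 and 1 of [n] realise the two ends of the
    spectrum. *)
Lemma mean_digit_set_nat n : mean_digit_set c n%:R !=set0.
Proof.
exists (point_of_digits c (fun=> n)); split; first exact: point_of_digits01.
apply/cvg_ratioP => e e0; apply: nearW => k.
rewrite (_ : digit_sum _ _ _ = (n * k)%N); last first.
  rewrite /digit_sum (eq_bigr (fun=> n)); last first.
    by move=> i _; exact: digit_point_of_digits.
  by rewrite sum_nat_const card_ord mulnC.
by rewrite natrM subrr normr0 mulr_ge0// ltW.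
Qed.

Lemma lyap_values_min : lyap_values c (- ln (1 - c)).
Proof.
have [x] := mean_digit_set_nat 0; rewrite -J_mean_digit_set ?lexx//= => -[x01].
by rewrite mul0r subr0; exists x.
Qed.

Lemma lyap_values_max : lyap_values c (- ln (1 - c) - ln c).
Proof.
have [x /(mean_digit_set_sub_J c01 (lexx _))] := mean_digit_set_nat 1.
by exists x.
Qed.

Lemma lyap_values_bounds a : lyap_values c a ->
  - ln (1 - c) <= a <= - ln (1 - c) - ln c.
Proof.
move=> [x [x01 ax]]; apply/andP; split.
  apply: (cvgr_to_ge ax); exists 1%N => // n n1.
  by have /andP[] := lyap_avg_bounds c01 x01 n1.
apply: (cvgr_to_le ax); exists 1%N => // n n1.
by have /andP[] := lyap_avg_bounds c01 x01 n1.
Qed.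

Lemma alpha_mE : alpha_m c = - ln (1 - c).
Proof.
have lb : lbound (lyap_values c) (- ln (1 - c)).
  by move=> a /lyap_values_bounds/andP[].
apply/eqP; rewrite eq_le; apply/andP; split.
  by apply: ge_inf lyap_values_min; exists (- ln (1 - c)).
by apply: lb_le_inf => //; exists (- ln (1 - c)); exact: lyap_values_min.
Qed.

Lemma alpha_ME : alpha_M c = - ln (1 - c) - ln c.
Proof.
have ub : ubound (lyap_values c) (- ln (1 - c) - ln c).
  by move=> a /lyap_values_bounds/andP[].
apply/eqP; rewrite eq_le; apply/andP; split.
  by apply: ge_sup => //; exists (- ln (1 - c) - ln c); exact: lyap_values_max.
by apply: ub_le_sup lyap_values_max; exists (- ln (1 - c) - ln c).
Qed.

(** The frequency of services that belongs to the exponent [a], written as an affine function to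
    suit [real_analytic_at_ln_affine]. *)
Let freq a := (- ln c)^-1 * a + ln (1 - c) / - ln c.

(** The formula of [hausdorff_dim_J] as a function of the exponent. It extends continuously to
    [alpha_M c], where its value differs from the dimension. *)
Definition dim_spectrum a :=
  ((1 + freq a) * ln (1 + freq a) - freq a * ln (freq a)) / a.

Lemma hausdorff_dim_J_freq a : alpha_m c < a < alpha_M c ->
  hausdorff_dim (J c a) = (dim_spectrum a)%:E.
Proof.
rewrite alpha_mE alpha_ME => /andP[ma aM].
have L0 : 0 < - ln c by rewrite oppr_gt0.
have fE : freq a = (a + ln (1 - c)) / - ln c by rewrite /freq mulrC -mulrDl.
have aE : a = - ln (1 - c) - freq a * ln c.
  by rewrite fE -mulrN divfK ?gt_eqF//; lra.
rewrite {1}aE hausdorff_dim_J; first by rewrite -aE.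
rewrite fE divr_gt0//=; last by lra.
by rewrite ltr_pdivrMr// mul1r; lra.
Qed.

Lemma real_analytic_dim_spectrum a : alpha_m c < a < alpha_M c ->
  real_analytic_at dim_spectrum a.
Proof.
rewrite alpha_mE alpha_ME => /andP[ma aM].
have L0 : 0 < - ln c by rewrite oppr_gt0.
have f0 : 0 < freq a.
  by rewrite /freq mulrC -mulrDl divr_gt0//; lra.
pose u := (- ln c)^-1; pose v := ln (1 - c) / - ln c.
have affine_ln w : 0 < u * a + w ->
    real_analytic_at (fun x => (u * x + w) * ln (u * x + w)) a.
  move=> h; have g := real_analytic_at_ln_affine h.
  have := real_analytic_atD (real_analytic_atZ u (real_analytic_at_mulX g))
    (real_analytic_atZ w g).
  by apply: eq_real_analytic_at => x; ring.
have a0 : a != 0 by rewrite gt_eqF// (lt_trans _ ma)// oppr_gt0.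
have h1 := affine_ln v f0.
have h2 : real_analytic_at (fun x => (1 + freq x) * ln (1 + freq x)) a.
  have := affine_ln (v + 1); rewrite addrA => /(_ (addr_gt0 f0 ltr01)).
  by apply: eq_real_analytic_at => x; rewrite addrA [1 + _]addrC.
have := real_analytic_at_divX a0 (real_analytic_atD h2 (real_analytic_atZ (-1) h1)).
by apply: eq_real_analytic_at => x; rewrite mulN1r.
Qed.

(** At frequency 1 the value is [ln 4 / - ln (c * (1 - c))], and [c * (1 - c) < 4^-1] since [c]
    differs from [2^-1]. *)
Lemma dim_spectrum_max_lt1 : dim_spectrum (alpha_M c) < 1.
Proof.
have /andP[c0 c1] := c01; have cb : 0 < 1 - c by rewrite subr_gt0.
have c2 : 2^-1 < c by case/andP: c_half.
have L0 : - ln c != 0 by rewrite oppr_eq0 lt_eqF.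
have -> : dim_spectrum (alpha_M c) = ln 4 / - ln (c * (1 - c)).
  rewrite /dim_spectrum (_ : freq _ = 1); last first.
    by rewrite /freq alpha_ME; field; rewrite oppr_eq0 in L0.
  rewrite ln1 mulr0 subr0 alpha_ME -opprD -lnM ?posrE// [(1 - c) * c]mulrC; congr (_ / _).
  by rewrite (_ : 4 = (1 + 1) * (1 + 1) :> R) ?lnM ?posrE//; lra.
have h0 : 0 < c * (1 - c) by rewrite mulr_gt0.
have h4 : c * (1 - c) < 4^-1.
  have : 0 < (c - 2^-1) * (c - 2^-1) by rewrite mulr_gt0// subr_gt0.
  lra.
rewrite ltr_pdivrMr; last first.
  by rewrite oppr_gt0 ln_lt0// h0/=; lra.
by rewrite mul1r -lnV ?posrE// ltr_ln ?posrE ?invr_gt0// -[4]invrK ltf_pV2 ?posrE.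
Qed.

Lemma dim_spectrum_max_cvg :
  dim_spectrum a @[a --> alpha_M c] --> dim_spectrum (alpha_M c).
Proof.
have L0 : - ln c != 0 by rewrite oppr_eq0 lt_eqF.
have aM0 : 0 < alpha_M c by rewrite alpha_ME addr_gt0 ?oppr_gt0.
have f1 : freq (alpha_M c) = 1.
  by rewrite /freq alpha_ME; field; rewrite oppr_eq0 in L0.
have fc : freq a @[a --> alpha_M c] --> freq (alpha_M c).
  by apply: cvgD; [apply: cvgMr; exact: cvg_id|exact: cvg_cst].
have fc1 : 1 + freq a @[a --> alpha_M c] --> 1 + freq (alpha_M c).
  by apply: cvgD; [exact: cvg_cst|exact: fc].
have lnc (g : R -> R) : 0 < g (alpha_M c) ->
    g a @[a --> alpha_M c] --> g (alpha_M c) ->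
    g a * ln (g a) @[a --> alpha_M c] --> g (alpha_M c) * ln (g (alpha_M c)).
  move=> g0 gc; apply: cvgM => //.
  by apply: continuous_cvg gc; exact: continuous_ln.
apply: cvgM; last first.
  by apply: cvgV; [rewrite gt_eqF|exact: cvg_id].
apply: cvgB; last by apply: lnc; [rewrite f1|exact: fc].
by apply: (lnc (fun a => 1 + freq a)); [rewrite f1 addr_gt0|exact: fc1].
Qed.

End Spectrum.

Theorem proposition4p4 (R : realType) (lambda : R)
    (hlambda : 2^-1 < lambda < 1) :
  [/\ forall t : R, t > - ln 2 / ln lambda ->
        hausdorff_dim
          (J lambda (- ln (1 - lambda)
                     - lambda `^ t * ln lambda / (1 - lambda `^ t)))
        = ((t * ln (1 - lambda) - ln (1 - lambda `^ t))
             / (- ln (1 - lambda)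
                - lambda `^ t * ln lambda / (1 - lambda `^ t))
           + t)%:E,
      hausdorff_dim (J lambda (- ln (lambda * (1 - lambda)))) = 1%E,
      (alpha_m lambda = - ln (1 - lambda) /\
       alpha_M lambda = - ln (lambda * (1 - lambda))),
      (forall alpha : R, alpha_m lambda < alpha < alpha_M lambda ->
        real_analytic_at (fun a => fine (hausdorff_dim (J lambda a))) alpha) &
      ~ (hausdorff_dim (J lambda a)
           @[a --> within `[alpha_m lambda, alpha_M lambda]%classic
                          (nbhs (alpha_M lambda))]
         --> hausdorff_dim (J lambda (alpha_M lambda)))].
Proof.
have /andP[l_half l1] := hlambda.
have l0 : 0 < lambda by lra.
have l01 : 0 < lambda < 1 by rewrite l0.
have [ll ll'] := ln01_lt0 l01.
have aM : alpha_M lambda = - ln (lambda * (1 - lambda)).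
  by rewrite alpha_ME// lnM ?posrE ?subr_gt0// opprD addrC.
split.
- move=> t ht; set q := lambda `^ t.
  have q0 : 0 < q by rewrite powR_gt0.
  have lnq : ln q = t * ln lambda by rewrite /q ln_powR.
  (* The threshold on [t] says that [q < 2^-1], hence that [digit_mean q < 1], where digit mean and
     frequency of services agree. *)
  have q_half : q < 2^-1.
    rewrite -ltr_ln ?posrE ?invr_gt0// lnq lnV ?posrE//.
    by move: ht; rewrite ltr_ndivrMr.
  have q01 : 0 < q < 1 by rewrite q0; lra.
  have mq : digit_mean q < 1.
    by rewrite /digit_mean ltr_pdivrMr; lra.
  have -> : q * ln lambda / (1 - q) = digit_mean q * ln lambda.
    by rewrite /digit_mean mulrAC.
  rewrite J_mean_digit_set ?mq ?(ltW (digit_mean_gt0 q01))//.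
  rewrite hausdorff_dim_mean_digit_set//; congr (_%:E).
  have := log_cylinder_lt0 l01 (ltW (digit_mean_gt0 q01)).
  rewrite /level_dim /log_cylinder lnq !mul1r => a0.
  have a0' : - ln (1 - lambda) - digit_mean q * ln lambda != 0.
    by rewrite -opprD oppr_eq0 lt_eqF.
  by field; rewrite a0' lt_eqF.
- exact: hausdorff_dim_J_max.
- by rewrite alpha_mE.
- move=> a ma; apply: real_analytic_at_near (real_analytic_dim_spectrum hlambda ma).
  have /near_in_itvoo : a \in `]alpha_m lambda, alpha_M lambda[ by rewrite in_itv.
  apply: filterS => b; rewrite in_itv/= => mb.
  by rewrite hausdorff_dim_J_freq.
have -> : hausdorff_dim (J lambda (alpha_M lambda)) = 1%E.
  by rewrite aM hausdorff_dim_J_max.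
move=> /fine_cvg dim1.
have D1 := dim_spectrum_max_lt1 hlambda.
(* Continuity would force dimensions above [m] near [alpha_M lambda], whereas [dim_spectrum], the
   dimension to the left of that point, stays below [m]. *)
pose m := (dim_spectrum lambda (alpha_M lambda) + 1) / 2.
have m1 : m < 1 by rewrite /m; lra.
have Dm : dim_spectrum lambda (alpha_M lambda) < m by rewrite /m; lra.
have gt_m : \forall b \near alpha_M lambda, `[alpha_m lambda, alpha_M lambda]%classic b ->
    m < fine (hausdorff_dim (J lambda b)).
  by apply: (cvgr_gt _ dim1).
have lt_m : \forall b \near alpha_M lambda, dim_spectrum lambda b < m.
  by apply: (cvgr_lt _ (dim_spectrum_max_cvg hlambda)).
have mM : alpha_m lambda < alpha_M lambda.
  by rewrite alpha_mE// alpha_ME// ltrDl oppr_gt0.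
have [d /= d0 dP] := (nbhs_ballP _ _).1 (filterI gt_m lt_m).
(* The point [alpha_M lambda - e] lies both in the ball of radius [d] and in the open interval where
   [dim_spectrum] gives the dimension. *)
pose e := Num.min d (alpha_M lambda - alpha_m lambda) / 2.
have e0 : 0 < e by rewrite divr_gt0// lt_min d0 subr_gt0.
have ed : e < d.
  by rewrite /e ltr_pdivrMr// gt_min mulr2n mulrDr mulr1 ltrDl d0.
have eM : e < alpha_M lambda - alpha_m lambda.
  rewrite /e ltr_pdivrMr// gt_min mulr2n mulrDr mulr1.
  by rewrite [X in _ || X]ltrDl subr_gt0 mM orbT.
have aP : alpha_m lambda < alpha_M lambda - e < alpha_M lambda.
  by apply/andP; split; lra.
have [] := dP (alpha_M lambda - e).
  by rewrite /ball/= opprB addrC subrK gtr0_norm.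
rewrite hausdorff_dim_J_freq//= => h lt; case/andP: aP => aP1 aP2.
have : m < dim_spectrum lambda (alpha_M lambda - e).
  by apply: h; rewrite /= in_itv/= !ltW.
by rewrite ltNge (ltW lt).
Qed.
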